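(* Let $n>3$ and $m\ge3$ be integers, $\mathbf d=(d_1,\dots,d_m)$ a vector of positive integers with $d=\sum_id_i$, and let $$\omega=\sum_{i\neq j}\lambda_{ij}\hat F_{ij}\,dF_i\wedge dF_j\in H^0(\mathbb P^n,\Omega^2_{\mathbb P^n}(d))$$ be a polynomial logarithmic 2-form of type $\mathbf d$, where $\lambda=(\lambda_{ij})\in\bigwedge^2\mathbb C^m$ satisfies $i_{\mathbf d}(\lambda)=0$ and $F_i\in\mathbb C[x_0,\dots,x_n]$ is homogeneous of degree $d_i$. If the polynomials $F_1,\dots,F_m$ have simple normal crossings, then the following conditions are equivalent: (i) $\omega\wedge\omega=0$; (ii) $\lambda\wedge\lambda=0$.
   Context: Everything is over $\mathbb C$. $\hat F_{ij}=\prod_{k\ne i,j}F_k$. $\lambda_{ij}=-\lambda_{ji}$ are the antisymmetric coordinates of $\lambda\in\bigwedge^2\mathbb C^m$; $i_{\mathbf d}:\bigwedge^2\mathbb C^m\to\mathbb C^m$ is the interior product by $\mathbf d$, determined by $i_{\mathbf d}(e_i\wedge e_j)=d_ie_j-d_je_i$. Elements of $H^0(\mathbb P^n,\Omega^2_{\mathbb P^n}(d))$ are identified with polynomial 2-forms on $\mathbb C^{n+1}$ of total degree $d$ (coefficients homogeneous of degree $d-2$) annihilated by contraction with the Euler field $R=\sum_ix_i\frac{\partial}{\partial x_i}$. *)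

(* Defs.v *)
From HB Require Import structures.
From mathcomp Require Import all_boot all_order all_algebra.
From mathcomp Require Import complex.
From mathcomp Require Import reals.
From mathcomp Require Import mpoly.

Set Implicit Arguments.
Unset Strict Implicit.
Unset Printing Implicit Defensive.

Import GRing.Theory.
Local Open Scope ring_scope.

(* The exterior algebra of A^N: u S is the coefficient of u on the basis
   element e_S = e_(i_1) /\ ... /\ e_(i_k), where S = {i_1 < ... < i_k}. The
   regular module A^o makes it an A-module. *)
Notation exterior A N := {ffun {set 'I_N} -> A^o}.

Section Exterior.
Variables (A : comNzRingType) (N : nat).
Implicit Types (u v : exterior A N) (S T : {set 'I_N}).

Definition ext_basis (i : 'I_N) : exterior A N := [ffun S : {set 'I_N} => (S == [set i])%:R].

Definition inversions S T : nat :=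
  #|[set p in setX S T | (p.2 < p.1)%N]|.

(* For disjoint T and U, e_T /\ e_U = (-1)^(inversions T U) e_(T :|: U); for
   non-disjoint ones it is 0. *)
Definition wedge u v : exterior A N :=
  [ffun S : {set 'I_N} => \sum_(T : {set 'I_N} | T \subset S)
     (-1) ^+ inversions T (S :\: T) * (u T : A) * (v (S :\: T) : A)].

(* Left contraction: for S = {i_1 < ... < i_k}, e_S is sent to
   \sum_r (-1)^(r-1) a_(i_r) e_(S \ i_r). *)
Definition interior (a : 'I_N -> A) u : exterior A N :=
  [ffun S : {set 'I_N} => \sum_(i | i \notin S)
     (-1) ^+ #|[set j in S | (j < i)%N]| * a i * (u (i |: S) : A)].

(* The element of the second exterior power with antisymmetric coordinates l. *)
Definition bivector (l : 'M[A]_N) : exterior A N :=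
  \sum_(i < N) \sum_(j < N | (i < j)%N) l i j *: wedge (ext_basis i) (ext_basis j).

Definition antisymmetric_mx (l : 'M[A]_N) : Prop := l^T = - l.

End Exterior.

(* Polynomial differential forms on affine N-space are the elements of
   exterior {mpoly C[N]} N, with ext_basis i standing for dx_i. *)
Definition dform (C : comNzRingType) (N : nat) (F : {mpoly C[N]}) :
    exterior {mpoly C[N]} N :=
  \sum_(i < N) (F^`M(i) : {mpoly C[N]}) *: ext_basis {mpoly C[N]} i.

Definition euler_field (C : comNzRingType) (N : nat) (i : 'I_N) :
  {mpoly C[N]} := 'X_i.

(* H^0(P^n, Omega^q(d)) with N = n + 1, for q <= d. *)
Definition twisted_form (C : comNzRingType) (N q d : nat)
    (w : exterior {mpoly C[N]} N) : Prop :=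
  [/\ forall S : {set 'I_N}, #|S| != q -> w S = 0,
      forall S : {set 'I_N}, (w S : {mpoly C[N]}) \is (d - q).-homog
    & interior (@euler_field C N) w = 0].

Definition log_form (C : comNzRingType) (N m : nat)
    (l : 'M[C]_m) (F : 'I_m -> {mpoly C[N]}) : exterior {mpoly C[N]} N :=
  \sum_(i < m) \sum_(j < m | j != i)
     ((l i j)%:MP * \prod_(k < m | (k != i) && (k != j)) F k)
       *: wedge (dform (F i)) (dform (F j)).

Definition grad_at (C : comNzRingType) (N : nat) (F : {mpoly C[N]})
  (x : 'rV[C]_N) : 'rV[C]_N := \row_i (F^`M(i)).@[x 0].

(* The differentials of the F_i through x are linearly independent, at each
   point [x] of the projective space with homogeneous coordinates x. The list
   is indexed by i, so a repeated hypersurface F_i = F_j is excluded. *)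
Definition simple_normal_crossings (C : fieldType) (N m : nat)
    (F : 'I_m -> {mpoly C[N]}) : Prop :=
  forall x : 'rV[C]_N, x != 0 ->
    free [seq grad_at (F i) x | i <- enum 'I_m & (F i).@[x 0] == 0].

Section ExteriorTheory.
Variables (A : comNzRingType) (N : nat).
Implicit Types (u v : exterior A N) (a : 'I_N -> A).
Local Notation e := (@ext_basis A N).

Fact wedge_is_linear u : linear (wedge u).
Proof.
move=> c v w; apply/ffunP => S; rewrite !ffunE /GRing.scale /= mulr_sumr -big_split /=.
apply: eq_bigr => T _; rewrite !ffunE /GRing.scale /= mulrDr; congr (_ + _).
by rewrite !mulrA; congr (_ * _); rewrite mulrC mulrA.
Qed.

Fact wedgel_is_linear v : linear (fun u => wedge u v).
Proof.
move=> c u w; apply/ffunP => S; rewrite !ffunE /GRing.scale /= mulr_sumr -big_split /=.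
apply: eq_bigr => T _; rewrite !ffunE /GRing.scale /= mulrDr mulrDl; congr (_ + _).
by rewrite !mulrA; congr (_ * _ * _); rewrite mulrC.
Qed.

Fact interior_is_linear a : linear (interior a).
Proof.
move=> c u w; apply/ffunP => S; rewrite !ffunE /GRing.scale /= mulr_sumr -big_split /=.
apply: eq_bigr => T _; rewrite !ffunE /GRing.scale /= mulrDr; congr (_ + _).
by rewrite !mulrA; congr (_ * _); rewrite mulrC mulrA.
Qed.

HB.instance Definition _ u :=
  GRing.isLinear.Build A (exterior A N) (exterior A N) _ (wedge u)
    (wedge_is_linear u).
HB.instance Definition _ a :=
  GRing.isLinear.Build A (exterior A N) (exterior A N) _ (interior a)
    (interior_is_linear a).

Lemma inversions1 (i j : 'I_N) : inversions [set i] [set j] = (j < i)%N.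
Proof.
rewrite /inversions; case: ltnP => hij.
  rewrite /= -(cards1 (i, j)); congr #|pred_of_set _|; apply/setP => -[a b].
  by rewrite !inE xpair_eqE /=; case: eqP => //= ->; case: eqP => //= ->.
apply: eq_card0 => -[a b]; rewrite !inE /=; apply/negP => /andP[/andP[]].
by move=> /eqP-> /eqP->; rewrite ltnNge hij.
Qed.

Lemma wedge_basisE (i j : 'I_N) (S : {set 'I_N}) :
  wedge (e i) (e j) S
  = (-1) ^+ (j < i)%N * ((i != j) && (S == [set i; j]))%:R.
Proof.
rewrite ffunE; case: (boolP (i \in S)) => iS; last first.
  rewrite big1 => [|T TS]; last first.
    rewrite !ffunE; case: eqP TS => [->|]; last by rewrite mulr0 mul0r.
    by rewrite sub1set (negPf iS).
  case: (S =P [set i; j]) => [eS|_]; last by rewrite andbF mulr0.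
  by rewrite eS !inE eqxx in iS.
rewrite (bigD1 [set i]) ?sub1set //= big1 ?addr0 => [|T /andP[_ /negPf nT]]; last first.
  by rewrite !ffunE nT mulr0 mul0r.
rewrite !ffunE eqxx mulr1.
have -> : (S :\: [set i] == [set j]) = (i != j) && (S == [set i; j]).
  apply/eqP/andP => [eS|[nij /eqP->]].
    have jS : j \in S :\ i by rewrite eS set11.
    split; first by move: jS; rewrite !inE eq_sym => /andP[].
    by rewrite -eS setD1K.
  by apply/setP => k; rewrite !inE; case: eqP => //= ->; rewrite (negPf nij).
case: (boolP (_ && _)) => [/andP[nij /eqP->]|]; last by rewrite !mulr0.
rewrite !mulr1 -inversions1; congr (_ ^+ inversions _ _).
by apply/setP => k; rewrite !inE; case: eqP => //= ->; rewrite (negPf nij).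
Qed.

Lemma interior_wedge_basis a (i j : 'I_N) :
  interior a (wedge (e i) (e j)) = a i *: e j - a j *: e i.
Proof.
apply/ffunP => S; rewrite !ffunE.
under eq_bigr => k _ do rewrite wedge_basisE.
case: (eqVneq i j) => [->|nij].
  by rewrite subrr big1 // => k _; rewrite !mulr0.
have nSi : ([set i] == [set j]) = false.
  by apply/eqP => /setP/(_ i); rewrite !inE eqxx (negPf nij).
have card1 (x y : 'I_N) : #|[set z in [set x] | (z < y)%N]| = (x < y)%N.
  case: ltnP => h.
    rewrite /= -(cards1 x); congr #|pred_of_set _|; apply/setP => z.
    by rewrite !inE; case: eqP => // ->.
  by apply: eq_card0 => z; rewrite !inE; case: eqP => //= ->; rewrite ltnNge h.
have other (k x y : 'I_N) : k \notin S ->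
    (k |: S == [set x; y]) -> x != y ->
    (k = x /\ S = [set y]) \/ (k = y /\ S = [set x]).
  move=> kS /eqP eS nxy; have: k \in [set x; y] by rewrite -eS !inE eqxx.
  have eS' : S = [set x; y] :\ k by rewrite -eS setU1K.
  rewrite !inE => /orP[]/eqP ek; [left|right]; split=> //; rewrite eS' ek.
    by apply/setP => z; rewrite !inE; case: eqP => //= ->; rewrite (negPf nxy).
  apply/setP => z; rewrite !inE; case: (eqVneq z y) => //= [->|_].
    by rewrite eq_sym (negPf nxy).
  by rewrite orbF.
case: (eqVneq S [set j]) => [eS|nSj].
  rewrite (bigD1 i) /=; last by rewrite eS inE.
  rewrite big1 => [|k /andP[kS nki]]; last first.
    case: eqP => [/eqP/(other _ _ _ kS)/(_ nij)|]; last by rewrite !mulr0.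
    case=> [[ki _]|[_ Si]]; first by rewrite ki eqxx in nki.
    by move: nSi; rewrite -Si eS eqxx.
  rewrite eS eqxx card1 eq_sym nSi /GRing.scale /= !mulr1 mulr0 subr0 addr0.
  by rewrite mulrAC -expr2 sqrr_sign mul1r.
case: (eqVneq S [set i]) => [eS|nSi'].
  rewrite (bigD1 j) /=; last by rewrite eS inE eq_sym.
  rewrite big1 => [|k /andP[kS nkj]]; last first.
    case: eqP => [/eqP/(other _ _ _ kS)/(_ nij)|]; last by rewrite !mulr0.
    case=> [[_ Sj]|[kj _]]; last by rewrite kj eqxx in nkj.
    by rewrite Sj eqxx in nSj.
  rewrite eS setUC eqxx card1 /GRing.scale /= !mulr1 mulr0 sub0r addr0.
  rewrite mulrAC; case: (ltngtP i j) => [h|h|/ord_inj h].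
  - by rewrite mulr1 expr1 mulN1r.
  - by rewrite mul1r expr1 mulN1r.
  - by rewrite h eqxx in nij.
rewrite /GRing.scale /= !mulr0 subr0 big1 // => k kS.
case: eqP => [/eqP/(other _ _ _ kS)/(_ nij)|]; last by rewrite !mulr0.
by case=> [[_ h]|[_ h]]; rewrite h eqxx in nSj nSi'.
Qed.

Lemma interiorZ a c u : interior a (c *: u) = c *: interior a u.
Proof. exact: linearZ. Qed.

End ExteriorTheory.

Section LogForms.

Fact scale_wedge_terms (A : comNzRingType) (V : lmodType A)
    (c p a f b g a' b' q r : A) (u v : V) :
  a' = a * c -> b' = - (b * c) -> p * f = q -> p * g = r ->
  (c * p) *: ((a * f) *: v - (b * g) *: u) = (a' * q) *: v + (b' * r) *: u.
Proof.
move=> -> -> <- <-; rewrite scalerBr !scalerA mulNr scaleNr.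
by congr (_ *: _ - _ *: _); rewrite mulrACA; congr (_ * _); rewrite mulrC.
Qed.

Fact sum_offdiag_eq0 (V : zmodType) (m : nat) (X : 'I_m -> 'I_m -> V) :
  (forall j, \sum_(i < m | i != j) X i j = 0) ->
  \sum_(i < m) \sum_(j < m | j != i) (X i j + X j i) = 0.
Proof.
move=> sX; under eq_bigr => i _ do rewrite big_split /= sX addr0.
rewrite (exchange_big_dep predT) //= big1 // => j _.
by rewrite -[RHS](sX j); apply: eq_bigl => i; rewrite eq_sym.
Qed.

Lemma interior_wedge1 (A : comNzRingType) (N : nat) (a f g : 'I_N -> A) :
  let form1 h := \sum_(i < N) h i *: ext_basis A i in
  interior a (wedge (form1 f) (form1 g))
  = (\sum_(i < N) a i * f i) *: form1 g - (\sum_(i < N) a i * g i) *: form1 f.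
Proof.
move=> form1.
have wZl (c : A) (u v : exterior A N) : wedge (c *: u) v = c *: wedge u v.
  apply/ffunP => S; rewrite !ffunE /GRing.scale /= mulr_sumr.
  apply: eq_bigr => T _; rewrite !ffunE /GRing.scale /= !mulrA.
  by congr (_ * _ * _); rewrite mulrC.
have w0l (v : exterior A N) : wedge 0 v = 0.
  by have := wZl 0 0 v; rewrite !scale0r.
have wsl (v : exterior A N) :
    wedge (form1 f) v = \sum_(i < N) f i *: wedge (ext_basis A i) v.
  apply: (big_ind2 (fun u w => wedge u v = w)) => [|u1 ? w1 ? <- <-|i _].
  - exact: w0l.
  - by have := wedgel_is_linear v 1 u1 w1; rewrite !scale1r.
  - exact: wZl.
rewrite wsl linear_sum /=.
under eq_bigr => i _ do rewrite !linearZ /= linear_sum linear_sum /=.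
under eq_bigr => i _.
  under eq_bigr => j _ do rewrite !linearZ /= interior_wedge_basis scalerBr !scalerA.
  rewrite sumrB scalerBr !scaler_sumr; over.
rewrite sumrB; congr (_ - _).
  rewrite scaler_suml; apply: eq_bigr => i _.
  rewrite /form1 scaler_sumr; apply: eq_bigr => j _; rewrite !scalerA.
  by congr (_ *: _); rewrite ?mulrA mulrAC; congr (_ * _); rewrite mulrC.
rewrite exchange_big scaler_suml; apply: eq_bigr => j _.
rewrite /form1 scaler_sumr; apply: eq_bigr => i _; rewrite !scalerA.
by congr (_ *: _); rewrite -?mulrA [RHS]mulrA [RHS]mulrC [a j * _]mulrC.
Qed.

Lemma euler_identity (C : comNzRingType) (N d : nat) (F : {mpoly C[N]}) :
  F \is d.-homog -> \sum_(i < N) 'X_i * F^`M(i) = d%:R *: F.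
Proof.
move=> /dhomogP hF; rewrite [in RHS](mpolyE F) scaler_sumr.
under eq_bigr => i _ do rewrite {1}(mpolyE F) linear_sum mulr_sumr.
rewrite exchange_big /=; apply: eq_big_seq => M /hF dM.
under eq_bigr => i _.
  rewrite linearZ /= mderivX -!scalerAr scalerA.
  have -> : (F@_M * (M i)%:R) *: ('X_i * 'X_[M - U_(i)])
            = (F@_M * (M i)%:R) *: 'X_[C, M].
    case: (posnP (M i)) => [->|M_gt0]; first by rewrite mulr0 !scale0r.
    by rewrite -mpolyXD addmC submK // lep1mP -lt0n.
  over.
rewrite -scaler_suml -mulr_sumr -natr_sum -mdegE dM.
by rewrite scalerA mulrC.
Qed.

Variables (C : comNzRingType) (N m : nat).
Variables (d : 'I_m -> nat) (l : 'M[C]_m) (F : 'I_m -> {mpoly C[N]}).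
Hypothesis l_anti : antisymmetric_mx l.
Hypothesis l_d : interior (fun i => (d i)%:R) (bivector l) = 0.
Hypothesis F_homog : forall i, F i \is (d i).-homog.

Lemma contraction_coord (j : 'I_m) :
  \sum_(i < m | i != j) (d i)%:R * l i j = 0.
Proof.
have lC (i k : 'I_m) : l i k = - l k i.
  by move/matrixP/(_ k i): l_anti; rewrite !mxE.
have /ffunP/(_ [set j]) := l_d.
rewrite [RHS]ffunE /bivector linear_sum sum_ffunE /= => {2}<-.
under [RHS]eq_bigr => i _.
  rewrite linear_sum sum_ffunE /=.
  under eq_bigr => k _.
    rewrite linearZ /= interior_wedge_basis !ffunE /GRing.scale /=.
    rewrite !(inj_eq set1_inj) mulrBr; over.
  rewrite sumrB; over.
rewrite sumrB.
have -> : \sum_(i < m) \sum_(k < m | (i < k)%N)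
     l i k * ((d k)%:R * (j == i)%:R) = - \sum_(k < m | (j < k)%N) (d k)%:R * l k j.
  rewrite (bigD1 j) //= [X in _ + X]big1 ?addr0 => [|i nij]; last first.
    by rewrite big1 // => k _; rewrite eq_sym (negPf nij) !mulr0.
  rewrite -sumrN; apply: eq_bigr => k _.
  by rewrite eqxx mulr1 lC mulNr mulrC.
rewrite opprK.
have -> : \sum_(i < m) \sum_(k < m | (i < k)%N)
     l i k * ((d i)%:R * (j == k)%:R) = \sum_(i < m | (i < j)%N) (d i)%:R * l i j.
  rewrite [RHS]big_mkcond; apply: eq_bigr => i _; rewrite big_mkcond.
  rewrite (bigD1 j) //= big1 ?addr0 => [|k nkj]; last first.
    by rewrite eq_sym (negPf nkj) !mulr0 if_same.
  by case: ifP => // _; rewrite eqxx mulr1 mulrC.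
rewrite (bigID (fun i : 'I_m => (i < j)%N)) /=; congr (_ + _); apply: eq_bigl => i.
  by case: eqP => [->|] //=; rewrite ltnn.
by rewrite -leqNgt ltn_neqAle eq_sym.
Qed.

Lemma dform_homog e (G : {mpoly C[N]}) (S : {set 'I_N}) :
  G \is e.-homog ->
  (dform G S : {mpoly C[N]}) \is e.-1.-homog /\ (#|S| != 1%N -> dform G S = 0).
Proof.
move=> hG; rewrite sum_ffunE; split.
  apply: rpred_sum => i _; rewrite !ffunE /GRing.scale /=.
  case: eqP => _; last by rewrite mulr0 rpred0.
  rewrite mulr1; apply/dhomogP => M; rewrite mcoeff_msupp mcoeff_deriv => nz.
  have : G@_(M + U_(i)) != 0 by apply: contra_neq nz => ->; rewrite mul0rn.
  rewrite -mcoeff_msupp => /(dhomogP _ _ _ hG) /=; rewrite mdegD mdeg1 addn1.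
  by move=> <-.
move=> nS; rewrite big1 // => i _; rewrite !ffunE; case: eqP => [eS|_].
  by rewrite eS cards1 in nS.
by rewrite scaler0.
Qed.

Lemma log_form_twisted :
  (forall i, (0 < d i)%N) -> twisted_form 2 (\sum_(i < m) d i) (log_form l F).
Proof.
move=> d_gt0.
have split2 (j i : 'I_m) (f : 'I_m -> nat) : j != i ->
    (\sum_(k < m) f k = f i + (f j + \sum_(k < m | (k != i) && (k != j)) f k))%N.
  by move=> nji; rewrite (bigD1 i) //= (bigD1 j).
split=> [S nS|S|].
- rewrite sum_ffunE big1 // => i _; rewrite sum_ffunE big1 // => j _.
  rewrite !ffunE [X in _ *: X]big1 ?scaler0 // => T TS.
  case: (eqVneq #|T| 1%N) => [T1|T1]; last first.
    by rewrite (dform_homog T (F_homog i)).2 // mulr0 mul0r.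
  rewrite (dform_homog _ (F_homog j)).2 ?mulr0 // cardsD (setIidPr TS) T1.
  apply: contra_neq nS => h; have: (#|T| <= #|S|)%N by apply: subset_leq_card.
  by rewrite T1; case: #|S| h => // -[|[|k]].
- rewrite sum_ffunE; apply: rpred_sum => i _; rewrite sum_ffunE.
  apply: rpred_sum => j nji; rewrite !ffunE /GRing.scale /= mulr_sumr.
  apply: rpred_sum => T _.
  have -> : (\sum_(k < m) d k - 2 =
      (0 + \sum_(k < m | (k != i) && (k != j)) d k) + (((0 + (d i).-1) + (d j).-1)))%N.
    rewrite (split2 _ _ _ nji) -{1}(prednK (d_gt0 i)) -{1}(prednK (d_gt0 j)).
    by rewrite !add0n addSn addSn addnS subn2 /= addnA addnC.
  apply: dhomogM; [apply: dhomogM | apply: dhomogM; [apply: dhomogM |]].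
  + by rewrite -[(l i j)%:MP]mulr1 mul_mpolyC; apply: dhomogZ; apply: dhomog1.
  + elim/big_rec2: _ => [|k p q _ hp]; first exact: dhomog1.
    by apply: dhomogM.
  + by rewrite -signr_odd; case: odd; rewrite ?expr0 ?expr1 ?dhomogN; apply: dhomog1.
  + exact: (dform_homog T (F_homog i)).1.
  + exact: (dform_homog _ (F_homog j)).1.
pose E := @euler_field C N.
have eulerF i : \sum_(k < N) E k * (F i)^`M(k) = (d i)%:R%:MP * F i.
  by rewrite mul_mpolyC; apply: euler_identity (F_homog i).
have iw i j : interior E (wedge (dform (F i)) (dform (F j)))
    = ((d i)%:R%:MP * F i) *: dform (F j) - ((d j)%:R%:MP * F j) *: dform (F i).
  rewrite -!eulerF.
  exact: (interior_wedge1 E (fun k => (F i)^`M(k)) (fun k => (F j)^`M(k))).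
pose P i j := \prod_(k < m | (k != i) && (k != j)) F k.
pose Q i := \prod_(k < m | k != i) F k.
have PQ i j : j != i -> P i j * F j = Q i.
  by move=> nji; rewrite /Q (bigD1 j) //= mulrC.
have PC i j : P i j = P j i by apply: eq_bigl => k; rewrite andbC.
pose X i j : exterior {mpoly C[N]} N :=
  (((d i)%:R * l i j)%:MP * Q j) *: dform (F j).
have sX j : \sum_(i < m | i != j) X i j = 0.
  rewrite /X -scaler_suml -mulr_suml -rmorph_sum /= contraction_coord.
  by rewrite mpolyC0 mul0r scale0r.
have term i j : j != i ->
    interior E (((l i j)%:MP * P i j) *: wedge (dform (F i)) (dform (F j)))
    = X i j + X j i.
  move=> nji; rewrite interiorZ iw /X; apply: scale_wedge_terms.
  - exact: mpolyCM.
  - have -> : l j i = - l i j by move/matrixP/(_ i j): l_anti; rewrite !mxE.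
    by rewrite mulrN mpolyCN mpolyCM.
  - by rewrite PC; apply: PQ; rewrite eq_sym.
  - exact: PQ.
transitivity (\sum_(i < m) \sum_(j < m | j != i) (X i j + X j i)).
  rewrite linear_sum; apply: eq_bigr => i _.
  by rewrite linear_sum; apply: eq_bigr => j /term.
exact: sum_offdiag_eq0 sX.
Qed.

End LogForms.

(* Main.v *)
(** Put F = prod_i F_i and t_i = (F / F_i) dF_i, so that
    F omega = sum_(i,j) l_ij t_i /\ t_j. Both conditions are equivalent to the
    vanishing of all l_ab l_cq - l_ac l_bq + l_aq l_bc. If these vanish, the
    sum squares to 0, by antisymmetrising the fourfold wedges. Conversely, since
    n > 3 the hypersurfaces F_a, F_b, F_c, F_q have a common point p. Let I be
    the set of i such that F_i(p) = 0. By normal crossings there is v with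
    dF_i(p) v = 1 for all i in I; on the line p + T v the polynomial F / F_i is
    T^(#|I| - 1) times a polynomial G_i with G_i(0) != 0 iff i is in I. Dividing
    by the power of T and setting T = 0 leaves a bivector in the independent
    covectors dF_i(p), i in I, which squares to 0; contracting with dual vectors
    gives the relations.

    The common point comes from the projective Nullstellensatz, proved by
    eliminating the last variable with a resultant: were there no such point,
    the polynomial ring would be finite over the subring generated by the four
    forms, which is impossible by counting monomials. *)
Require Import Defs.
From mathcomp Require Import all_boot all_order all_algebra.
From mathcomp Require Import complex.
From mathcomp Require Import reals.
From mathcomp Require Import mpoly.
From mathcomp Require Import boolp ring zify.

Set Implicit Arguments.
Unset Strict Implicit.
Unset Printing Implicit Defensive.

Import GRing.Theory.
Import Num.Theory.
Local Open Scope ring_scope.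

(** * The exterior algebra *)

Section WedgeAlgebra.
Variables (A : comNzRingType) (N : nat).
Implicit Types (u v : exterior A N) (S T U : {set 'I_N}) (f g h a : 'I_N -> A).
Local Notation e := (@ext_basis A N).

Lemma inversionsUl S T U : [disjoint S & T] ->
  inversions (S :|: T) U = (inversions S U + inversions T U)%N.
Proof.
move=> dST; rewrite /inversions -cardsUI [X in (_ + X)%N]eq_card0 ?addn0 => [|[i j]].
  apply: eq_card => -[i j]; rewrite !inE.
  by case: (i \in S); case: (i \in T); case: (j \in U); rewrite ?andbF ?orbF ?orbb.
rewrite !inE /=; apply/negP => /andP[/andP[/andP[iS _] _] /andP[/andP[iT _] _]].
by rewrite (disjointFr dST iS) in iT.
Qed.

Lemma inversionsUr S T U : [disjoint T & U] ->
  inversions S (T :|: U) = (inversions S T + inversions S U)%N.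
Proof.
move=> dTU; rewrite /inversions -cardsUI [X in (_ + X)%N]eq_card0 ?addn0 => [|[i j]].
  apply: eq_card => -[i j]; rewrite !inE.
  by case: (i \in S); case: (j \in T); case: (j \in U); rewrite ?andbF ?orbF ?orbb.
rewrite !inE /=; apply/negP => /andP[/andP[/andP[_ jT] _] /andP[/andP[_ jU] _]].
by rewrite (disjointFr dTU jT) in jU.
Qed.

(** Both sides sum over the ordered partitions of [S] into three blocks, and the signs agree because
    [inversions] is additive over disjoint unions in each argument. *)
Lemma wedgeA u v w : wedge (wedge u v) w = wedge u (wedge v w).
Proof.
apply/ffunP => S; rewrite !ffunE.
under eq_bigr => T _ do rewrite ffunE mulr_sumr mulr_suml.
under [RHS]eq_bigr => T _ do rewrite ffunE mulr_sumr.
rewrite (exchange_big_dep (fun T => T \subset S)) /=; last first.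
  by move=> T U TS UT; apply: subset_trans UT TS.
apply: eq_bigr => T TS.
rewrite (reindex_onto (fun U => T :|: U) (fun U => U :\: T)) /=; last first.
  by move=> U /andP[_ TU]; rewrite setUC -{2}(setID U T) (setIidPr TU) setUC.
have UTK U : ((T :|: U) :\: T == U) = [disjoint U & T].
  by rewrite setDUl setDv set0U; apply/eqP/setDidPl.
apply: eq_big => [U|U /andP[/andP[TUS _]]].
  by rewrite subUset TS subsetUl UTK subsetD andbT.
rewrite UTK => dUT; have /eqP -> : (T :|: U) :\: T == U by rewrite UTK.
rewrite -setDDl; set W := S :\: T :\: U.
have US : U \subset S :\: T by rewrite subsetD dUT andbT (subset_trans _ TUS) ?subsetUr.
have eUW : S :\: T = U :|: W by rewrite /W setUC -{1}(setID (S :\: T) U) (setIidPr US) setUC.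
have dUW : [disjoint U & W].
  by rewrite disjoint_sym disjoints_subset /W setDE subsetIr.
rewrite eUW (inversionsUr _ dUW) inversionsUl 1?disjoint_sym // !exprD; ring.
Qed.

Let below S x : nat := #|[set j in S | (j < x)%N]|.

Lemma belowU1 (i : 'I_N) S (x : nat) : i \notin S -> below (i |: S) x = ((i < x)%N + below S x)%N.
Proof.
move=> iS; rewrite /below; case: ltnP => i_x.
  rewrite -(setD1K (_ : i \in [set j in i |: S | (j < x)%N])) ?inE ?eqxx //.
  rewrite cardsU1 !inE eqxx /=; congr (_ + _)%N; apply: eq_card => j; rewrite !inE.
  by case: eqP => [->|]; rewrite ?(negPf iS).
apply: eq_card => j; rewrite !inE.
by case: eqP => [->|//]; rewrite (negPf iS) ltnNge i_x.
Qed.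

Lemma wedge_basis_coord k u S :
  wedge (e k) u S = if k \in S then (-1) ^+ below (S :\ k) k * (u (S :\ k) : A) else 0.
Proof.
rewrite ffunE; case: ifP => kS; last first.
  rewrite big1 // => T TS; rewrite !ffunE; case: eqP TS => [->|]; last by rewrite mulr0 mul0r.
  by rewrite sub1set kS.
rewrite (bigD1 [set k]) ?sub1set //= big1 ?addr0 => [|T /andP[_ /negPf nT]]; last first.
  by rewrite !ffunE nT mulr0 mul0r.
rewrite !ffunE eqxx mulr1; congr ((-1) ^+ _ * _); rewrite /inversions /below.
have pair_inj : injective (pair k : 'I_N -> 'I_N * 'I_N) by move=> i j [].
rewrite -(card_imset _ pair_inj); apply: eq_card => -[i j]; rewrite !inE /=.
apply/andP/imsetP => [[/andP[/eqP-> jS] ji]|[j' j'S [-> ->]]]; first by exists j; rewrite ?inE ?jS.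
by move: j'S; rewrite !inE eqxx /= => /andP[-> ->].
Qed.

Lemma interior_coord a u S :
  interior a u S = \sum_(i | i \notin S) (-1) ^+ below S i * a i * (u (i |: S) : A).
Proof. by rewrite ffunE. Qed.

(** Contraction is an antiderivation. At a set without [k] only the term [i = k] survives. At a set
    containing [k], that term of the right-hand contraction cancels [a k *: u], and every other sign
    flips because exactly one of [k < i] and [i < k] holds. *)
Lemma interior_wedge_basis1 a k u :
  interior a (wedge (e k) u) = a k *: u - wedge (e k) (interior a u).
Proof.
apply/ffunP => S.
have -> : (a k *: u - wedge (e k) (interior a u)) S
    = a k * (u S : A) - (wedge (e k) (interior a u) S : A) by rewrite !ffunE.
rewrite interior_coord.
under eq_bigr => i _ do rewrite wedge_basis_coord.
rewrite wedge_basis_coord interior_coord.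
case: (boolP (k \in S)) => kS; last first.
  rewrite (bigD1 k) //= setU11 setU1K // big1 ?addr0 ?subr0 => [|i /andP[iS nik]].
    by rewrite mulrACA -expr2 sqrr_sign mul1r.
  by rewrite !inE eq_sym (negPf nik) (negPf kS) mulr0.
rewrite [X in _ = _ - _ * X](bigD1 k) ?setD11 //= setD1K //.
rewrite mulrDr opprD !mulrA -expr2 sqrr_sign mul1r addNKr.
rewrite mulr_sumr -sumrN; apply: eq_big => [i|i iS].
  by rewrite !inE negb_and negbK; case: eqP => [->|_]; rewrite ?kS ?andbT ?andbF.
have nki : k != i by apply: contraNneq iS => <-.
rewrite !inE kS orbT.
have -> : (i |: S) :\ k = i |: (S :\ k).
  by apply/setP => j; rewrite !inE; case: (eqVneq j k) => [->|]; rewrite ?(negPf nki).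
rewrite -{1}(setD1K kS) !belowU1 ?setD11 ?inE ?negb_and ?iS ?orbT //.
rewrite !exprD !mulrA; case: (ltngtP k i) => [||/val_inj ki].
- by move=> _; ring.
- by move=> _; ring.
- by rewrite ki eqxx in nki.
Qed.


Lemma wedgeZl c u v : wedge (c *: u) v = c *: wedge u v.
Proof.
have := wedgel_is_linear v c u 0; rewrite addr0 => ->.
have /= := wedgel_is_linear v (-1) 0 0; rewrite scaler0 addr0 scaleN1r addNr => ->.
by rewrite addr0.
Qed.

Lemma wedgeZr c u v : wedge u (c *: v) = c *: wedge u v.
Proof. exact: linearZ. Qed.

Lemma wedgeDl u u' v : wedge (u + u') v = wedge u v + wedge u' v.
Proof. by have /= := wedgel_is_linear v 1 u u'; rewrite !scale1r. Qed.

Lemma wedgeNl u v : wedge (- u) v = - wedge u v.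
Proof. by rewrite -scaleN1r wedgeZl scaleN1r. Qed.

Lemma wedge_suml (I : Type) (r : seq I) (P : pred I) (x : I -> exterior A N) v :
  wedge (\sum_(i <- r | P i) x i) v = \sum_(i <- r | P i) wedge (x i) v.
Proof.
elim/big_rec2: _ => [|i y w _ <-]; first by have := wedgeZl 0 0 v; rewrite !scale0r.
by have /= := wedgel_is_linear v 1 (x i) w; rewrite !scale1r.
Qed.

Definition form1 f : exterior A N := \sum_i f i *: e i.

Definition pairing a f : A := \sum_i a i * f i.

Lemma form1_coord f k : form1 f [set k] = f k.
Proof.
rewrite sum_ffunE (bigD1 k) //= !ffunE eqxx big1 ?addr0 => [|i nik].
  by rewrite /GRing.scale /= mulr1.
by rewrite !ffunE (inj_eq set1_inj) eq_sym (negPf nik) scaler0.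
Qed.

Lemma eq_form1 f g : f =1 g -> form1 f = form1 g.
Proof. by move=> fg; apply: eq_bigr => i _; rewrite fg. Qed.

Lemma form1Z c f : form1 (fun i => c * f i) = c *: form1 f.
Proof. by rewrite scaler_sumr; apply: eq_bigr => i _; rewrite scalerA. Qed.

Lemma form1D f g : form1 (fun i => f i + g i) = form1 f + form1 g.
Proof. by rewrite -big_split; apply: eq_bigr => i _; rewrite scalerDl. Qed.

Lemma form1_sum (I : finType) (x : I -> 'I_N -> A) :
  form1 (fun i => \sum_t x t i) = \sum_t form1 (x t).
Proof. by rewrite exchange_big; apply: eq_bigr => i _; rewrite scaler_suml. Qed.

Lemma wedge_basisC (i j : 'I_N) : wedge (e i) (e j) = - wedge (e j) (e i).
Proof.
apply/ffunP => S; rewrite [RHS]ffunE !wedge_basisE eq_sym setUC.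
case: (ltngtP i j) => [_|_|/val_inj ->]; last by rewrite eqxx mulr0 oppr0.
  by rewrite expr0 expr1 mul1r mulN1r opprK.
by rewrite expr0 expr1 mul1r mulN1r.
Qed.

Lemma wedge_form1C f g : wedge (form1 f) (form1 g) = - wedge (form1 g) (form1 f).
Proof.
have expand x y : wedge (form1 x) (form1 y) = \sum_i \sum_j (x i * y j) *: wedge (e i) (e j).
  rewrite wedge_suml; apply: eq_bigr => i _; rewrite wedgeZl linear_sum scaler_sumr.
  by apply: eq_bigr => j _; rewrite linearZ scalerA.
rewrite !expand exchange_big -sumrN; apply: eq_bigr => i _; rewrite -sumrN.
by apply: eq_bigr => j _; rewrite wedge_basisC scalerN mulrC.
Qed.

Lemma interior_form1_wedge a f u :
  interior a (wedge (form1 f) u) = pairing a f *: u - wedge (form1 f) (interior a u).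
Proof.
rewrite !wedge_suml linear_sum /= scaler_suml -sumrB; apply: eq_bigr => i _.
rewrite !wedgeZl linearZ /= interior_wedge_basis1 scalerBr scalerA.
by rewrite [a i * _]mulrC.
Qed.

Lemma interior_wedge_form1 a f g :
  interior a (wedge (form1 f) (form1 g)) = pairing a f *: form1 g - pairing a g *: form1 f.
Proof. exact: interior_wedge1. Qed.

(** * Bivectors built from a family of covectors *)

Section BivectorForms.
Variables (m : nat) (l : 'M[A]_m) (t : 'I_m -> 'I_N -> A).

(** The sum runs over ordered pairs, so for antisymmetric [l] every wedge is counted twice. Standard
    covectors [t i] give twice [bivector l], and the forms (F / F_i) dF_i give F omega, so one
    computation serves both sides of the equivalence. *)
Definition biform : exterior A N :=
  \sum_i \sum_j l i j *: wedge (form1 (t i)) (form1 (t j)).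

Lemma wedge_biforml u :
  wedge biform u = \sum_i \sum_j l i j *: wedge (form1 (t i)) (wedge (form1 (t j)) u).
Proof.
rewrite wedge_suml; apply: eq_bigr => i _; rewrite wedge_suml; apply: eq_bigr => j _.
by rewrite wedgeZl wedgeA.
Qed.

Lemma biform_form1C f : wedge biform (form1 f) = wedge (form1 f) biform.
Proof.
rewrite wedge_biforml linear_sum; apply: eq_bigr => i _.
rewrite linear_sum; apply: eq_bigr => j _; rewrite linearZ /=; congr (_ *: _).
by rewrite wedge_form1C linearN /= -!wedgeA wedge_form1C wedgeNl opprK.
Qed.

(** No sign appears because [biform] has even degree: the contraction passes two covectors. *)
Lemma interior_biform_wedge a u :
  interior a (wedge biform u) = wedge (interior a biform) u + wedge biform (interior a u).
Proof.
rewrite !wedge_biforml !linear_sum wedge_suml -big_split; apply: eq_bigr => i _ /=.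
rewrite !linear_sum wedge_suml -big_split; apply: eq_bigr => j _ /=.
rewrite !linearZ /= wedgeZl -scalerDr; congr (_ *: _).
rewrite interior_wedge_form1 !interior_form1_wedge.
rewrite linearB linearZ /= wedgeDl wedgeNl !wedgeZl opprB.
by rewrite addrA addrAC -addrA addrC.
Qed.

Hypothesis l_anti : antisymmetric_mx l.

Lemma anti_coord i j : l i j = - l j i.
Proof. by move/matrixP/(_ j i): l_anti; rewrite !mxE. Qed.

(** The two terms of each contraction become equal after exchanging the indices, by antisymmetry;
    hence the factor 2. *)
Lemma interior_biform a :
  interior a biform
  = form1 (fun k => (\sum_i \sum_j l i j * pairing a (t i) * t j k) *+ 2).
Proof.
have -> : interior a biform
    = \sum_i \sum_j (l i j * pairing a (t i)) *: form1 (t j) *+ 2.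
  rewrite linear_sum /=; under eq_bigr => i _ do rewrite linear_sum /=.
  under eq_bigr => i _.
    under eq_bigr => j _ do rewrite linearZ /= interior_wedge_form1 scalerBr !scalerA.
    rewrite sumrB; over.
  rewrite sumrB [X in _ - X]exchange_big -sumrB; apply: eq_bigr => i _.
  rewrite -sumrB; apply: eq_bigr => j _.
  by rewrite (anti_coord j i) mulNr scaleNr opprK mulr2n.
rewrite (eq_form1 (fun k => mulr2n _)) form1D -mulr2n form1_sum.
rewrite [LHS](_ : _ = (\sum_i \sum_j (l i j * pairing a (t i)) *: form1 (t j)) *+ 2).
  congr (_ *+ 2); apply: eq_bigr => i _; rewrite form1_sum.
  by under [RHS]eq_bigr => j _ do rewrite form1Z.
by rewrite -sumrMnl; apply: eq_bigr => i _; rewrite -sumrMnl.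
Qed.

(** The Pfaffian of the submatrix of [l] on four indices. For antisymmetric [l] and increasing
    indices, twice this number is the corresponding coordinate of lambda /\ lambda. *)
Definition pfaffian (i j k q : 'I_m) : A := l i j * l k q - l i k * l j q + l i q * l j k.

(** Renaming summation indices turns the coefficient [l i j * l k q] into each of the three terms of
    the Pfaffian, up to the sign of the permutation of the fourfold wedge. Adding the three
    expressions of the square leaves Pfaffians as coefficients; the multiple 3 stays because 3 need
    not be invertible in [A]. *)
Lemma biform_sq_of_pfaffian :
  (forall i j k q, pfaffian i j k q = 0) -> wedge biform biform *+ 3 = 0.
Proof.
move=> pf0.
pose W i j k q := wedge (form1 (t i)) (wedge (form1 (t j)) (wedge (form1 (t k)) (form1 (t q)))).
have swap f g u : wedge (form1 f) (wedge (form1 g) u) = - wedge (form1 g) (wedge (form1 f) u).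
  by rewrite -!wedgeA wedge_form1C wedgeNl.
have W23 i j k q : W i j k q = - W i k j q by rewrite /W (swap (t j)) linearN.
have W34 i j k q : W i j k q = - W i j q k.
  by rewrite /W wedge_form1C !linearN.
pose X (c : 'I_m -> 'I_m -> 'I_m -> 'I_m -> A) :=
  \sum_i \sum_j \sum_k \sum_q c i j k q *: W i j k q.
have XE : wedge biform biform = X (fun i j k q => l i j * l k q).
  rewrite wedge_biforml; apply: eq_bigr => i _; apply: eq_bigr => j _.
  rewrite !linear_sum /=; apply: eq_bigr => k _.
  rewrite !linear_sum /=; apply: eq_bigr => q _.
  by rewrite !linearZ /= scalerA mulrC.
have X2 : wedge biform biform = X (fun i j k q => - (l i k * l j q)).
  rewrite XE; apply: eq_bigr => i _; rewrite exchange_big; apply: eq_bigr => j _.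
  apply: eq_bigr => k _; apply: eq_bigr => q _.
  by rewrite W23 scalerN scaleNr.
have X3 : wedge biform biform = X (fun i j k q => l i q * l j k).
  rewrite XE; apply: eq_bigr => i _.
  under [RHS]eq_bigr => j _ do rewrite exchange_big.
  rewrite [RHS]exchange_big; apply: eq_bigr => j _; apply: eq_bigr => k _.
  by apply: eq_bigr => q _ /=; rewrite (W34 i k q j) (W23 i k j q) opprK.
rewrite (mulrS _ 2) mulr2n {1}XE {1}X2 X3 /X -!big_split big1 // => i _ /=.
rewrite -!big_split big1 // => j _ /=; rewrite -!big_split big1 // => k _ /=.
rewrite -!big_split big1 // => q _ /=; rewrite -!scalerDl addrA.
by have := pf0 i j k q; rewrite /pfaffian => ->; rewrite scale0r.
Qed.

Section Dual.
Variables (w : 'I_m -> 'I_N -> A) (G : 'I_m -> A).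
Hypothesis w_dual : forall a j : 'I_m, pairing (w a) (t j) = (a == j)%:R * G j.

Let contracted (a : 'I_m) k := G a *+ 2 * \sum_j l a j * t j k.

Lemma interior_dual (a : 'I_m) : interior (w a) biform = form1 (contracted a).
Proof.
rewrite interior_biform; apply: eq_form1 => k; rewrite /contracted.
rewrite mulrnAl; congr (_ *+ 2); rewrite (bigD1 a) //= [X in _ + X]big1 ?addr0 => [|i nia].
  by rewrite mulr_sumr; apply: eq_bigr => j _; rewrite w_dual eqxx mul1r mulrAC mulrC.
by rewrite big1 // => j _; rewrite w_dual eq_sym (negPf nia) mul0r mulr0 mul0r.
Qed.

Lemma pairing_contracted (a b : 'I_m) : pairing (w b) (contracted a) = (G a * G b * l a b) *+ 2.
Proof.
rewrite /pairing /contracted.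
rewrite [LHS](_ : _ = G a *+ 2 * \sum_j l a j * pairing (w b) (t j)); last first.
  rewrite mulr_sumr; under [RHS]eq_bigr => j _ do rewrite !mulr_sumr.
  rewrite exchange_big; apply: eq_bigr => k _; rewrite !mulr_sumr.
  by apply: eq_bigr => j _; ring.
rewrite (bigD1 b) //= big1 ?addr0 => [|j njb]; last first.
  by rewrite w_dual eq_sym (negPf njb) mul0r mulr0.
by rewrite w_dual eqxx mul1r; ring.
Qed.

(** Contract the vanishing square with [w a], [w b] and [w c], and pair the remaining covector with
    [w q]; duality leaves only a weighted Pfaffian. The 8 is the 2 from contracting a square times a
    2 for each of the two pairings in a product. Weights [G j] equal to 0 are allowed. *)
Lemma pfaffian_of_biform_sq (a b c q : 'I_m) : wedge biform biform = 0 ->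
  (G a * G b * G c * G q * pfaffian a b c q) *+ 8 = 0.
Proof.
move=> sq0.
have sq1 : wedge (form1 (contracted a)) biform *+ 2 = 0.
  have := congr1 (interior (w a)) sq0; rewrite linear0 interior_biform_wedge.
  by rewrite interior_dual biform_form1C -mulr2n.
have sq2 := congr1 (interior (w b)) sq1.
rewrite linear0 linearMn /= interior_form1_wedge interior_dual in sq2.
have sq3 := congr1 (interior (w c)) sq2.
rewrite linear0 linearMn /= linearB linearZ /= interior_dual interior_wedge_form1 in sq3.
(* The coordinates of the covector left after three contractions. *)
pose h k := (pairing (w b) (contracted a) * contracted c k
  - (pairing (w c) (contracted a) * contracted b k
     - pairing (w c) (contracted b) * contracted a k)) *+ 2.
have h0 k : h k = 0.
  have /ffunP/(_ [set k]) := sq3; rewrite [RHS]ffunE; apply: etrans.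
  by rewrite ffunMnE !ffunE !form1_coord.
have : pairing (w q) h = 0 by rewrite /pairing big1 // => k _; rewrite h0 mulr0.
rewrite [LHS](_ : _ = (pairing (w b) (contracted a) * pairing (w q) (contracted c)
  - (pairing (w c) (contracted a) * pairing (w q) (contracted b)
     - pairing (w c) (contracted b) * pairing (w q) (contracted a))) *+ 2).
  by rewrite !pairing_contracted /pfaffian => <-; ring.
rewrite [LHS]/pairing /h.
rewrite [X in _ = (X - _) *+ 2]mulr_sumr [X in _ = (_ - (X - _)) *+ 2]mulr_sumr.
rewrite [X in _ = (_ - (_ - X)) *+ 2]mulr_sumr -!sumrB -sumrMnl.
by apply: eq_bigr => k _; ring.
Qed.

End Dual.
End BivectorForms.
End WedgeAlgebra.

(** * Homogeneous ideals and common zeros *)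

Definition ideal_pred (A : comNzRingType) (I : A -> Prop) : Prop :=
  [/\ I 0, forall p q, I p -> I q -> I (p + q) & forall p q, I q -> I (p * q)].

Definition homog_ideal (K : fieldType) (n : nat) (I : {mpoly K[n]} -> Prop) :=
  forall p e, I p -> I (pihomog mdeg e p).

Lemma ideal_sum (A : comNzRingType) (I : A -> Prop) (T : Type) (s : seq T)
    (P : pred T) (f : T -> A) :
  ideal_pred I -> (forall i, P i -> I (f i)) -> I (\sum_(i <- s | P i) f i).
Proof. by case=> I0 ID _ If; elim/big_ind: _. Qed.

(** A nonzero member of least degree generates: otherwise the remainder of some member by it is a
    nonzero member of smaller degree. *)
Lemma poly_ideal_principal (K : fieldType) (J : {poly K} -> Prop) (h0 : {poly K}) :
  ideal_pred J -> J h0 -> h0 != 0 ->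
  exists h, [/\ J h, h != 0 & forall q, J q -> h %| q].
Proof.
move=> [_ JD JM]; have [k] := ubnP (size h0).
elim: k h0 => // k IH h0 /ltnSE size_h0 Jh0 h0_neq0.
have [dvd_h0|] := EM (forall q, J q -> h0 %| q); first by exists h0.
move=> /existsNP[q /not_implyP[Jq /negP ndvd]].
apply: (IH (q %% h0)); last by rewrite -/(_ %| _).
  exact: leq_trans (ltn_modpN0 _ h0_neq0) size_h0.
have -> : q %% h0 = q + (- (q %/ h0)) * h0.
  by rewrite {2}(divp_eq q h0) mulNr addrAC subrr add0r.
by apply: JD => //; apply: JM.
Qed.

(* The library's map_resultant covers only coefficients in a polynomial ring. *)
Lemma resultant_map (aR rR : nzRingType) (f : {rmorphism aR -> rR}) (p q : {poly aR}) :
  f (lead_coef p) != 0 -> f (lead_coef q) != 0 ->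
  f (resultant p q) = resultant (map_poly f p) (map_poly f q).
Proof.
move=> fp_neq0 fq_neq0; rewrite /resultant /Sylvester_mx !size_map_poly_id0 //.
rewrite -det_map_mx map_col_mx; congr (\det (col_mx _ _));
  by apply: map_lin1_mx => v; rewrite map_poly_rV rmorphM /= map_rVpoly.
Qed.

(** * Splitting off the last variable *)

Section LastVariable.
Variables (K : fieldType) (n : nat).
Implicit Types (p : {mpoly K[n.+1]}) (a : 'I_n -> K) (b : K).

Let widen (i : 'I_n) : 'I_n.+1 := widen_ord (leqnSn n) i.

Definition mnm_init (mu : 'X_{1..n.+1}) : 'X_{1..n} := [multinom mu (widen i) | i < n].

Lemma mnm_initK mu :
  mu = (mnmwiden (mnm_init mu) + U_(ord_max) *+ mu ord_max)%MM.
Proof.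
apply/mnmP => i; rewrite mnmDE mulmnE mnm1E.
case: (unliftP ord_max i) => [j ->|->]; last first.
  by rewrite mnmwiden_ordmax eqxx mul1n.
have -> : lift ord_max j = widen j by apply: val_inj; exact: lift_max.
rewrite mnmwiden_widen mnmE.
have -> : (ord_max == widen j) = false.
  by apply/eqP => /(congr1 val) /= e; have := ltn_ord j; rewrite -e ltnn.
by rewrite mul0n addn0.
Qed.

Lemma mdeg_mnmwiden (mu : 'X_{1..n}) : mdeg (mnmwiden mu) = mdeg mu.
Proof.
rewrite !mdegE big_ord_recr /= mnmwiden_ordmax addn0.
by apply: eq_bigr => i _; rewrite mnmwiden_widen.
Qed.

Lemma mdeg_mnm_init mu : mdeg mu = (mdeg (mnm_init mu) + mu ord_max)%N.
Proof. by rewrite {1}[mu]mnm_initK mdegD mdeg_mnmwiden mdegMn mdeg1 mul1n. Qed.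

(** Undoes [muni], which views a polynomial as univariate in the last variable. *)
Definition eval_last (q : {poly {mpoly K[n]}}) : {mpoly K[n.+1]} :=
  (map_poly (@mwiden n K) q).['X_ord_max].

Lemma eval_lastD q1 q2 : eval_last (q1 + q2) = eval_last q1 + eval_last q2.
Proof. by rewrite /eval_last rmorphD hornerD. Qed.

Lemma eval_lastM q1 q2 : eval_last (q1 * q2) = eval_last q1 * eval_last q2.
Proof. by rewrite /eval_last rmorphM hornerM. Qed.

Lemma eval_lastC q : eval_last q%:P = mwiden q.
Proof. by rewrite /eval_last map_polyC hornerC. Qed.

Lemma mpolyX_last mu :
  'X_[mu] = mwiden 'X_[mnm_init mu] * 'X_ord_max ^+ mu ord_max :> {mpoly K[n.+1]}.
Proof. by rewrite {1}[mu]mnm_initK mpolyXD mwidenX mpolyXn. Qed.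

Lemma muniK p : eval_last (muni p) = p.
Proof.
rewrite muniE /eval_last rmorph_sum horner_sum /= [RHS]mpolyE.
apply: eq_bigr => mu _.
rewrite -mul_polyC rmorphM /= map_polyC map_polyXn hornerM hornerC hornerXn /=.
by rewrite -mul_mpolyC rmorphM /= mwidenC -mulrA -mpolyX_last mul_mpolyC.
Qed.

Definition extend a b (i : 'I_n.+1) : K := if insub (val i) is Some j then a j else b.

Lemma extend_widen a b i : extend a b (widen i) = a i.
Proof. by rewrite /extend /= valK. Qed.

Lemma extend_max a b : extend a b ord_max = b.
Proof. by rewrite /extend /= insubF ?ltnn. Qed.

Lemma meval_extend p a b : p.@[extend a b] = (map_poly (meval a) (muni p)).[b].
Proof.
rewrite muniE rmorph_sum horner_sum /= {1}[p]mpolyE raddf_sum /=.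
apply: eq_bigr => mu _.
rewrite -mul_polyC rmorphM /= map_polyC map_polyXn hornerM hornerC hornerXn /=.
rewrite !mevalZ !mevalX big_ord_recr /= extend_max -mulrA; congr (_ * (_ * _)).
by apply: eq_bigr => i _; rewrite -/(widen i) extend_widen mnmE.
Qed.

(** By homogeneity every monomial has degree at most [e] in the last variable, and the pure power is
    the only one attaining it. *)
Lemma muni_last_monic p e (c : K) :
  p \is e.-homog -> p@_(U_(ord_max) *+ e)%MM = c -> c != 0 ->
  lead_coef (muni p) = c%:MP.
Proof.
move=> p_hom pc c_neq0.
have coefE k : (muni p)`_k =
    \sum_(mu <- msupp p) (p@_mu *: 'X_[mnm_init mu]) * (k == mu ord_max)%:R.
  by rewrite muniE coef_sum; apply: eq_bigr => mu _; rewrite coefZ coefXn.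
have size_le : (size (muni p) <= e.+1)%N.
  apply/leq_sizeP => k lt_ek; rewrite coefE big_seq big1 // => mu mu_in.
  have : mdeg mu = e := dhomog_mf p_hom mu_in; rewrite mdeg_mnm_init => deg_mu.
  case: eqP => [ek|_]; last by rewrite mulr0.
  by move: lt_ek; rewrite ek -deg_mu ltnNge leq_addl.
have coef_e : (muni p)`_e = c%:MP.
  rewrite coefE (bigD1_seq (U_(ord_max) *+ e)%MM) ?msupp_uniq //=; last first.
    by rewrite mcoeff_msupp pc.
  rewrite big_seq_cond big1 ?addr0 => [|mu /andP[mu_in neq_mu]].
    rewrite pc mulmnE mnm1E eqxx mul1n eqxx mulr1.
    have -> : mnm_init (U_(ord_max) *+ e) = 0%MM.
      apply/mnmP => i; rewrite mnmE mulmnE mnm1E mnm0E.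
      case: eqP => [/(congr1 val) /= ei|]; last by rewrite mul0n.
      by have := ltn_ord i; rewrite -ei ltnn.
    by rewrite mpolyX0 alg_mpolyC.
  case: eqP => [ek|_]; last by rewrite mulr0.
  have : mdeg mu = e := dhomog_mf p_hom mu_in; rewrite mdeg_mnm_init -ek => /eqP.
  rewrite -[X in _ == X]add0n eqn_add2r mdeg_eq0 => /eqP init0.
  move: neq_mu; rewrite [mu]mnm_initK init0 -ek.
  have -> : mnmwiden 0%MM = 0%MM :> 'X_{1..n.+1} by apply: mnmwiden0.
  by rewrite add0m eqxx.
have size_p : size (muni p) = e.+1.
  apply/eqP; rewrite eqn_leq size_le ltnNge; apply: contraNN c_neq0 => le_e.
  by rewrite -(mpolyC_eq0 n) -coef_e nth_default.
by rewrite lead_coefE size_p.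
Qed.

End LastVariable.

Lemma muni_last (K : fieldType) (n : nat) : muni 'X_ord_max = 'X :> {poly {mpoly K[n]}}.
Proof.
rewrite muniE msuppX big_seq1 mcoeffX eqxx scale1r mnm1E eqxx expr1.
have -> : [multinom (U_(@ord_max n) (widen_ord (leqnSn n) i))%MM | i < n] = 0%MM.
  apply/mnmP => i; rewrite mnmE mnm1E mnm0E; apply/eqP; rewrite eqb0; apply/eqP.
  by move=> /(congr1 val) /= ei; have := ltn_ord i; rewrite -ei ltnn.
by rewrite mpolyX0 scale1r.
Qed.

(** Specialising the first [n] variables at [a] turns [I] into an ideal of K[T]. A resultant shows
    that it is proper, given that the leading coefficient of [g] survives specialisation; a root of
    its generator serves as [b]. *)
Lemma ideal_zero_extends (K : closedFieldType) (n : nat) (I : {mpoly K[n.+1]} -> Prop)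
    (g : {mpoly K[n.+1]}) (c : K) (a : 'I_n -> K) :
  ideal_pred I -> I g -> lead_coef (muni g) = c%:MP -> c != 0 ->
  (forall q, I (mwiden q) -> q.@[a] = 0) ->
  exists b, forall p, I p -> p.@[extend a b] = 0.
Proof.
move=> idI Ig lc_g c_neq0 a_zero; have [I0 ID IM] := idI.
pose spec (q : {poly {mpoly K[n]}}) := map_poly (meval a) q.
have spec_lead : (lead_coef (muni g)).@[a] != 0 by rewrite lc_g mevalC.
(* If the last variable did not occur in [g], the nonzero constant [c] would lie in the elimination
   ideal and vanish at [a]. *)
have size_gt1 : (1 < size (muni g))%N.
  rewrite ltnNge; apply/negP => /size1_polyC g_const.
  have eg : g = mwiden c%:MP.
    by rewrite -[g]muniK g_const eval_lastC -lc_g [in RHS]g_const lead_coefC.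
  have := a_zero c%:MP; rewrite -eg mevalC => /(_ Ig) c0.
  by rewrite c0 eqxx in c_neq0.
pose J h := exists2 f, I f & spec (muni f) = h.
have idJ : ideal_pred J.
  split; first by exists 0 => //; rewrite /spec !rmorph0.
    move=> _ _ [f If <-] [f' If' <-].
    by exists (f + f'); [exact: ID | rewrite /spec !rmorphD].
  (* A multiplier in K[T] lifts to the same polynomial in the last variable. *)
  move=> h _ [f If <-]; exists ((map_poly (@mpolyC n.+1 K) h).['X_ord_max] * f).
    exact: IM.
  rewrite muniM /spec rmorphM /=; congr (_ * _).
  rewrite -!horner_map /= muni_last map_polyX -!map_poly_comp /=.
  rewrite (eq_map_poly (g := polyC)) => [|x]; last first.
    by rewrite /= muniC map_polyC /= mevalC.
  exact: comp_polyXr.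
have J1 : ~ J 1.
  move=> [f If spec_f]; pose s := size (muni f).
  (* Adding a high multiple of g gives a constant leading coefficient, so that
     the resultant with g commutes with specialisation at a. *)
  pose P := muni f + muni g * 'X^s.
  have g_neq0 : muni g != 0 by rewrite -size_poly_gt0 ltnW.
  have lt_f : (size (muni f) < size (muni g * 'X^s)%R)%N.
    by rewrite size_mulXn // -[X in (X < _)%N]addn0 ltn_add2l ltnW.
  have lead_P : lead_coef P = c%:MP.
    by rewrite lead_coefDr // lead_coef_Mmonic ?monicXn.
  have size_P : (1 < size P)%N.
    by rewrite /P addrC size_polyDl // size_mulXn // (leq_trans size_gt1) ?leq_addl.
  have eP : eval_last P = f + g * eval_last 'X^s.
    by rewrite -{1}(muniK f) -{1}(muniK g) -eval_lastM -eval_lastD.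
  have [[u v] _ /= res_uv] := resultant_in_ideal size_P size_gt1.
  have /a_zero : I (mwiden (resultant P (muni g))).
    have := congr1 (@eval_last K n) res_uv.
    rewrite eval_lastC [RHS]eval_lastD (eval_lastM u) (eval_lastM v) eP (muniK g) => ->.
    apply: (ID); last exact: IM.
    by apply: (IM); apply: (ID) => //; rewrite mulrC; exact: IM.
  have cP : (lead_coef P).@[a] != 0 by rewrite lead_P mevalC.
  (* The resultant lies in the elimination ideal, so it vanishes at [a]. The specialisations of [P]
     and [g] then share a factor of positive degree, which divides the specialisation of [f], namely
     1. *)
  rewrite (resultant_map cP spec_lead) => /eqP; rewrite resultant_eq0.
  apply/negP; rewrite -leqNgt; set D := gcdp _ _.
  have : D %| 1.
    rewrite -spec_f.
    have -> : spec (muni f) = spec P - spec (muni g) * 'X^s.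
      by rewrite /spec rmorphD rmorphM /= map_polyXn addrK.
    by rewrite dvdp_sub ?dvdp_gcdl // dvdp_mulr // dvdp_gcdr.
  by rewrite dvdp1 => /eqP ->.
have [h [[f If <-] h_neq0 h_dvd]] : exists h, [/\ J h, h != 0 & forall q, J q -> h %| q].
  apply: (poly_ideal_principal idJ (h0 := spec (muni g))); first by exists g.
  by rewrite /spec -size_poly_eq0 size_map_poly_id0 // -lt0n ltnW.
have /closed_rootP[b /rootP fb] : size (spec (muni f)) != 1%N.
  apply/eqP => /eqP/size_poly1P[e e_neq0 ef]; apply: J1.
  have -> : 1 = e^-1%:P * spec (muni f) by rewrite ef -polyCM mulVf.
  by case: idJ => _ _; apply; exists f.
exists b => p Ip; rewrite meval_extend.
have /dvdpP[q] : spec (muni f) %| spec (muni p) by apply: h_dvd; exists p.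
by rewrite -/(spec _) => ->; rewrite hornerM fb mulr0.
Qed.

(** At the vertex (0, ..., 0, 1) every monomial other than a pure power of the last variable
    vanishes. *)
Lemma meval_last_vertex (K : fieldType) (n : nat) (p : {mpoly K[n.+1]}) :
  p.@[fun i => (i == ord_max)%:R] != 0 ->
  exists e, p@_(U_(ord_max) *+ e)%MM != 0.
Proof.
move=> p_neq0; apply: contrapT => /forallNP p_coef.
move/eqP: p_neq0; apply; rewrite mevalE big_seq big1 // => mu mu_in.
case: (eqVneq mu (U_(ord_max) *+ mu ord_max)%MM) => [->|neq_mu].
  by have /negP := p_coef (mu ord_max); rewrite negbK => /eqP ->; rewrite mul0r.
have [i i_max mu_i] : exists2 i, i != ord_max & mu i != 0%N.
  apply: contrapT => noi; move/eqP: neq_mu; apply; apply/mnmP => i.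
  rewrite mulmnE mnm1E; case: (eqVneq ord_max i) => [<-|ni]; first by rewrite mul1n.
  rewrite mul0n; apply/eqP; apply: contrapT => /negP mi.
  by apply: noi; exists i => //; rewrite eq_sym.
by rewrite (bigD1 i) //= (negPf i_max) expr0n (negPf mu_i) mul0r mulr0.
Qed.

Lemma mcoeff_pihomog (K : fieldType) (n e : nat) (p : {mpoly K[n]}) (mu : 'X_{1..n}) :
  mdeg mu = e -> (pihomog mdeg e p)@_mu = p@_mu.
Proof.
move=> deg_mu; rewrite [in RHS](mpolyE p) pihomogE !raddf_sum /= [LHS]big_mkcond /=.
apply: eq_bigr => nu _; case: eqP => // ne; rewrite mcoeffZ mcoeffX.
by case: eqP => [e_nu|]; [rewrite e_nu deg_mu in ne | rewrite mulr0].
Qed.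

Lemma pihomog_mwiden (K : fieldType) (n e : nat) (p : {mpoly K[n]}) :
  pihomog mdeg e (mwiden p) = mwiden (pihomog mdeg e p).
Proof.
elim/mpolyind: p => [|c mu p _ _ IHp]; first by rewrite pihomog0 !mwiden0 pihomog0.
rewrite mwidenD !pihomogD mwidenD IHp mwidenZ mwidenX !linearZ /= mwidenZ.
have deg_mu := mdeg_mnmwiden mu.
rewrite !pihomogX; case: eqP => h; case: eqP => h'; rewrite ?mwidenX ?mwiden0 //.
  by case: h'; exact: etrans (esym deg_mu) h.
by case: h; exact: etrans deg_mu h'.
Qed.

(** Induction on the number of variables. Unless the vertex (0, ..., 0, 1) is a zero, [I] contains a
    form [g] involving a pure power of the last variable. A zero of the elimination ideal then
    extends to one of [I]; if instead that ideal contains all monomials of large degree, reduction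
    by [g] carries this over to [I]. *)
Theorem homog_ideal_zero_or_cofinite (K : closedFieldType) (n : nat)
    (I : {mpoly K[n]} -> Prop) :
  ideal_pred I -> homog_ideal I ->
  (exists2 x : 'I_n -> K, (exists i, x i != 0) & forall p, I p -> p.@[x] = 0) \/
  (exists D, forall mu : 'X_{1..n}, (D <= mdeg mu)%N -> I 'X_[mu]).
Proof.
elim: n I => [|n IHn] I idI homI; have [I0 ID IM] := idI.
  (* Without variables no monomial has positive degree. *)
  by right; exists 1%N => mu; rewrite mdegE big_ord0.
have [vertex|] := EM (forall p, I p -> p.@[fun i => (i == ord_max)%:R] = 0).
  left; exists (fun i => (i == ord_max)%:R) => //.
  by exists ord_max; rewrite eqxx oner_neq0.
move=> /existsNP[p /not_implyP[Ip /eqP/meval_last_vertex[e pe]]].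
pose g := pihomog mdeg e p.
have Ig : I g by apply: homI.
have g_hom : g \is e.-homog by apply: pihomogP.
pose c := g@_(U_(ord_max) *+ e)%MM.
have c_neq0 : c != 0 by rewrite /c mcoeff_pihomog // mdegMn mdeg1 mul1n.
have lead_g := muni_last_monic g_hom erefl c_neq0.
pose I' (q : {mpoly K[n]}) := I (mwiden q).
have idI' : ideal_pred I'.
  split; first by rewrite /I' raddf0.
    by move=> q q' Iq Iq'; rewrite /I' raddfD; apply: ID.
  by move=> q q' Iq'; rewrite /I' rmorphM; apply: IM.
have homI' : homog_ideal I'.
  move=> q k Iq; rewrite /I' -pihomog_mwiden; exact: homI.
have [[a [i ai] a_zero]|[D ID']] := IHn I' idI' homI'.
  left; have [b ab_zero] := ideal_zero_extends idI Ig lead_g c_neq0 a_zero.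
  exists (extend a b) => //; exists (widen_ord (leqnSn n) i).
  by rewrite extend_widen.
right; exists (D + e)%N => mu.
(* Reducing the last variable by g raises the degree in the others. *)
have [k] := ubnP (D - mdeg (mnm_init mu)); elim: k mu => // k IHk mu lt_k le_mu.
have [le_D|lt_D] := leqP D (mdeg (mnm_init mu)).
  by rewrite mpolyX_last mulrC; apply: IM; apply: ID'.
have le_e : (e <= mu ord_max)%N.
  by move: le_mu; rewrite mdeg_mnm_init; move: (mdeg _) (mu _) lt_D => x y; lia.
pose top := (U_(@ord_max n) *+ e)%MM.
have top_le : (top <= mu)%MM.
  apply/mnm_lepP => i; rewrite mulmnE mnm1E; case: eqP => [<-|_]; last by rewrite mul0n.
  by rewrite mul1n.
pose A : {mpoly K[n.+1]} := c^-1%:MP * 'X_[mu - top].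
have mu_e : 'X_[mu] = A * (c *: 'X_[top]) :> {mpoly K[n.+1]}.
  by rewrite -mul_mpolyC mulrACA -mpolyCM mulVf // mul1r -mpolyXD submK.
pose rest := \sum_(nu <- msupp g | nu != top) g@_nu *: 'X_[nu].
have g_top : g = c *: 'X_[top] + rest.
  rewrite {1}[g]mpolyE (bigD1_seq top) ?msupp_uniq //=.
  by rewrite mcoeff_msupp.
have -> : 'X_[mu] = A * g + (- A) * rest by rewrite mu_e g_top mulrDr mulNr addrK.
apply: (ID); first exact: IM.
rewrite mulr_sumr big_seq_cond; apply: ideal_sum => // nu /andP[nu_in neq_nu].
rewrite -mul_mpolyC mulNr mulrACA -mulNr -mpolyXD.
have deg_nu : mdeg nu = e := dhomog_mf g_hom nu_in.
(* [top] is the only monomial of degree [e] whose last exponent is [e]. *)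
have nu_max : (nu ord_max < e)%N.
  rewrite ltn_neqAle; apply/andP; split; last first.
    by rewrite -deg_nu mdeg_mnm_init leq_addl.
  apply: contraNneq neq_nu => nu_e.
  have /eqP : mdeg nu = nu ord_max by rewrite deg_nu.
  rewrite mdeg_mnm_init -[X in _ == X]add0n eqn_add2r mdeg_eq0 => /eqP init0.
  rewrite [nu]mnm_initK init0 nu_e.
  have -> : mnmwiden 0%MM = 0%MM :> 'X_{1..n.+1} by apply: mnmwiden0.
  by rewrite add0m.
have deg_new : mdeg (mu - top + nu) = mdeg mu.
  by rewrite mdegD -{2}(submK top_le) mdegD deg_nu mdegMn mdeg1 mul1n.
have max_new : ((mu - top + nu)%MM ord_max = mu ord_max - e + nu ord_max)%N.
  by rewrite mnmDE mnmBE mulmnE mnm1E eqxx mul1n.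
apply: (IM); apply: IHk; last by rewrite deg_new.
move: (mdeg_mnm_init (mu - top + nu)) (mdeg_mnm_init mu) lt_k.
by rewrite deg_new max_new; lia.
Qed.

(** * Counting monomials over the subring generated by a few forms *)

Definition lin_comb (K : fieldType) (V : lmodType K) (T : finType) (g : T -> V) (v : V) :=
  exists c : T -> K, v = \sum_t c t *: g t.

Section LinComb.
Variables (K : fieldType) (V : lmodType K) (T : finType) (g : T -> V).

Lemma lin_comb_gen t : lin_comb g (g t).
Proof.
exists (fun t' => (t' == t)%:R); rewrite (bigD1 t) //= eqxx scale1r big1 ?addr0 //.
by move=> t' /negPf ->; rewrite scale0r.
Qed.

Lemma lin_combZ k v : lin_comb g v -> lin_comb g (k *: v).
Proof.
case=> c ->; exists (fun t => k * c t); rewrite scaler_sumr.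
by apply: eq_bigr => t _; rewrite scalerA.
Qed.

Lemma lin_comb_sum (S : Type) (s : seq S) (P : pred S) (f : S -> V) :
  (forall i, P i -> lin_comb g (f i)) -> lin_comb g (\sum_(i <- s | P i) f i).
Proof.
move=> gf; elim/big_ind: _ => //.
  by exists (fun=> 0); rewrite big1 // => t _; rewrite scale0r.
move=> _ _ [c ->] [c' ->]; exists (fun t => c t + c' t); rewrite -big_split.
by apply: eq_bigr => t _; rewrite scalerDl.
Qed.

End LinComb.

(** With more monomials than generators, the coefficient matrix has a nonzero row in its kernel,
    which is a linear relation between distinct monomials. *)
Lemma monomials_span_card (K : fieldType) (n : nat) (S T : finType)
    (mon : S -> 'X_{1..n}) (g : T -> {mpoly K[n]}) :
  injective mon -> (forall s, lin_comb g 'X_[mon s]) -> (#|S| <= #|T|)%N.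
Proof.
move=> mon_inj /choice[c mon_c].
pose M := \matrix_(i < #|S|, j < #|T|) c (enum_val i) (enum_val j).
rewrite leqNgt; apply/negP => lt_TS.
have : kermx M != 0.
  rewrite kermx_eq0 /row_free; apply: contraTneq lt_TS => <-.
  by rewrite -leqNgt rank_leq_col.
case/rowV0Pn => u /sub_kermxP uM /eqP; apply; apply/rowP => i; rewrite mxE.
have : \sum_(i < #|S|) u 0 i *: 'X_[mon (enum_val i)] = 0 :> {mpoly K[n]}.
  under eq_bigr => k _ do rewrite mon_c scaler_sumr.
  rewrite exchange_big big1 //= => t _.
  under eq_bigr => k _ do rewrite scalerA.
  rewrite -scaler_suml; have /rowP/(_ (enum_rank t)) := uM.
  rewrite !mxE => uMt; rewrite [X in X *: _](_ : _ = 0) ?scale0r // -[RHS]uMt.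
  by apply: eq_bigr => k _; rewrite mxE enum_rankK.
move/(congr1 (mcoeff (mon (enum_val i)))); rewrite raddf_sum mcoeff0 /= => <-.
rewrite (bigD1 i) //= mcoeffZ mcoeffX eqxx mulr1 big1 ?addr0 // => k neq_ki.
rewrite mcoeffZ mcoeffX; case: eqP => [/mon_inj/enum_val_inj e|]; last by rewrite mulr0.
by rewrite e eqxx in neq_ki.
Qed.

(** The case split guards the truncated subtraction: a multiple of a form of degree [k] has no
    component of degree below [k]. *)
Lemma pihomogM (K : fieldType) (n k e : nat) (p q : {mpoly K[n]}) :
  q \is k.-homog ->
  pihomog mdeg e (p * q) = (if (k <= e)%N then pihomog mdeg (e - k) p else 0) * q.
Proof.
move=> q_hom; elim/mpolyind: p => [|c mu p _ _ IHp].
  by rewrite mul0r !pihomog0 if_same mul0r.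
have Xq : ('X_[mu] * q) \is (mdeg mu + k).-homog by apply: dhomogM => //; rewrite dhomogX.
have XX : 'X_[K, mu] \is (mdeg mu).-homog by rewrite dhomogX.
rewrite mulrDl !pihomogD IHp -scalerAl !linearZ /=.
suff -> : pihomog mdeg e ('X_[mu] * q)
    = (if (k <= e)%N then pihomog mdeg (e - k) 'X_[mu] else 0) * q.
  by case: ifP => _; [rewrite mulrDl -scalerAl | rewrite !mul0r scaler0 addr0].
have [e_mu|neq_e] := eqVneq (mdeg mu + k)%N e.
  by rewrite -e_mu leq_addl addnK !pihomog_dE.
rewrite (pihomog_ne0 neq_e Xq); case: leqP => [le_k|_]; last by rewrite mul0r.
rewrite (pihomog_ne0 _ XX) ?mul0r //.
by apply: contraNneq neq_e => ->; rewrite subnK.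
Qed.

Section FewForms.
Variables (K : closedFieldType) (n r : nat) (d : 'I_r -> nat) (F : 'I_r -> {mpoly K[n]}).
Hypothesis d_gt0 : forall j, (0 < d j)%N.
Hypothesis F_hom : forall j, F j \is (d j).-homog.

Definition form_ideal (p : {mpoly K[n]}) := exists G : 'I_r -> {mpoly K[n]}, p = \sum_j G j * F j.

Lemma form_idealP : ideal_pred form_ideal.
Proof.
split; first by exists (fun=> 0); rewrite big1 // => j _; rewrite mul0r.
  move=> _ _ [G ->] [G' ->]; exists (fun j => G j + G' j); rewrite -big_split.
  by apply: eq_bigr => j _; rewrite mulrDl.
move=> q _ [G ->]; exists (fun j => q * G j); rewrite mulr_sumr.
by apply: eq_bigr => j _; rewrite mulrA.
Qed.

Lemma pihomog_form_ideal e (G : 'I_r -> {mpoly K[n]}) :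
  pihomog mdeg e (\sum_j G j * F j) =
  \sum_j (if (d j <= e)%N then pihomog mdeg (e - d j) (G j) else 0) * F j.
Proof. by rewrite linear_sum; apply: eq_bigr => j _; apply: pihomogM. Qed.

Variable D : nat.
Hypothesis ID : forall mu : 'X_{1..n}, (D <= mdeg mu)%N -> form_ideal 'X_[mu].

(** Monomials with exponents below [D] generate the polynomial ring as a module over
    K[F_1, ..., F_r]. Bounding the exponents of the F_j by [L] makes the family finite, with
    [L ^ r * D ^ n] indices. *)
Definition standard_product (L : nat) (ab : {ffun 'I_r -> 'I_L} * {ffun 'I_n -> 'I_D}) :=
  'X_[[multinom (ab.2 i : nat) | i < n]] * \prod_j F j ^+ ab.1 j.

(** Induction on [e]. Below [D], expand [p] in monomials. Otherwise [p] lies in the ideal and each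
    F_j is absorbed into the product: its exponent rises by 1 while the degree falls by d_j >= 1, so
    the bound on [a j + e] persists. *)
Lemma standard_products_span L e (p : {mpoly K[n]}) (a : 'I_r -> nat) :
  p \is e.-homog -> (forall j, (a j + e < L)%N) ->
  lin_comb (@standard_product L) (p * \prod_j F j ^+ a j).
Proof.
have [k] := ubnP e; elim: k e p a => // k IHk e p a lt_ek p_hom lt_a.
have [le_De|lt_eD] := leqP D e; last first.
  rewrite (mpolyE p) mulr_suml big_seq; apply: lin_comb_sum => mu mu_in.
  rewrite -scalerAl; apply: lin_combZ.
  have lt_mu i : (mu i < D)%N.
    apply: leq_ltn_trans lt_eD.
    have <- : mdeg mu = e := dhomog_mf p_hom mu_in.
    by rewrite mdegE (bigD1 i) //= leq_addr.
  have lt_aL j : (a j < L)%N by apply: leq_ltn_trans (lt_a j); rewrite leq_addr.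
  have := lin_comb_gen (@standard_product L)
    ([ffun j => Ordinal (lt_aL j)], [ffun i => Ordinal (lt_mu i)]).
  congr (lin_comb _ (_ * _)); last by apply: eq_bigr => j _; rewrite ffunE.
  by congr 'X_[_]; apply/mnmP => i; rewrite mnmE /= ffunE.
have [G pG] : form_ideal p.
  rewrite (mpolyE p) big_seq; apply: ideal_sum form_idealP _ => mu mu_in.
  rewrite -mul_mpolyC; case: form_idealP => _ _; apply; apply: ID.
  by have -> : mdeg mu = e := dhomog_mf p_hom mu_in.
(* Taking components of degree [e] makes the coefficient of F_j homogeneous of degree [e - d j]. *)
rewrite -(pihomog_dE p_hom) pG pihomog_form_ideal mulr_suml.
apply: lin_comb_sum => j _; case: leqP => [le_dj|_]; last first.
  by rewrite !mul0r; exists (fun=> 0); rewrite big1 // => t _; rewrite scale0r.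
rewrite -mulrA; have -> : F j * \prod_i F i ^+ a i = \prod_i F i ^+ (a i + (i == j)).
  rewrite [LHS](_ : _ = \prod_i (F i ^+ (i == j) * F i ^+ a i)).
    by apply: eq_bigr => i _; rewrite addnC exprD.
  rewrite big_split; congr (_ * _); rewrite (bigD1 j) //= eqxx expr1 big1 ?mulr1 //.
  by move=> i /negPf ->.
apply: (IHk (e - d j)%N).
- by have := d_gt0 j; lia.
- exact: pihomogP.
- by move=> i; have := lt_a i; have := d_gt0 j; case: (i == j); lia.
Qed.

(** The [E ^ n] monomials with exponents below [E] have degree at most [n * E], so they lie in the
    span of the standard products with F-exponents at most [n * E]. *)
Lemma standard_products_bound E : (E ^ n <= (n * E).+1 ^ r * D ^ n)%N.
Proof.
have := @monomials_span_card K n {ffun 'I_n -> 'I_E}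
  ({ffun 'I_r -> 'I_(n * E).+1} * {ffun 'I_n -> 'I_D})%type
  (fun s => [multinom (s i : nat) | i < n]) (@standard_product _).
rewrite card_prod !card_ffun !card_ord; apply.
  by move=> s s' /mnmP e; apply/ffunP => i; apply: val_inj; have := e i; rewrite !mnmE.
move=> s; rewrite -['X_[_]]mulr1.
have -> : 1 = \prod_j F j ^+ 0 by rewrite big1.
apply: (@standard_products_span _ (mdeg [multinom (s i : nat) | i < n])).
  by rewrite dhomogX eqxx.
move=> j; rewrite add0n ltnS mdegE -[X in (X * _)%N]card_ord -sum_nat_const.
by apply: leq_sum => i _; rewrite mnmE ltnW.
Qed.
End FewForms.

(** Without a common zero, [E ^ n] would be bounded for all E by a polynomial in E of degree r <
    n. *)
Theorem few_forms_common_zero (K : closedFieldType) (n r : nat) (d : 'I_r -> nat)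
    (F : 'I_r -> {mpoly K[n]}) :
  (r < n)%N -> (forall j, (0 < d j)%N) -> (forall j, F j \is (d j).-homog) ->
  exists2 x : 'I_n -> K, (exists i, x i != 0) & forall j, (F j).@[x] = 0.
Proof.
move=> lt_rn d_gt0 F_hom.
have homI : homog_ideal (form_ideal F).
  move=> _ e [G ->]; rewrite (pihomog_form_ideal F_hom).
  by eexists (fun j => _); reflexivity.
have [[x x_neq0 x_zero]|[D ID]] := homog_ideal_zero_or_cofinite (form_idealP F) homI.
  exists x => // j; apply: x_zero; exists (fun i => (i == j)%:R).
  rewrite (bigD1 j) //= eqxx mul1r big1 ?addr0 // => i /negPf ->; exact: mul0r.
(* For E = M + 1, the count is at most (n + 1)^r E^r D^n = E^r M < E^(r + 1) <= E^n. *)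
exfalso; pose M := (n.+1 ^ r * D ^ n)%N.
have := standard_products_bound d_gt0 F_hom ID M.+1.
have le_n : ((n * M.+1).+1 <= n.+1 * M.+1)%N by rewrite mulSn addSn ltnS leq_addl.
have le1 : ((n * M.+1).+1 ^ r * D ^ n <= M.+1 ^ r * M)%N.
  rewrite [X in (_ <= _ * X)%N](_ : M = n.+1 ^ r * D ^ n)%N //.
  rewrite mulnA -expnMn [(M.+1 * _)%N]mulnC leq_mul //.
  case: (posnP r) => [r0|r_gt0]; last by rewrite leq_exp2r.
  by rewrite [in X in (X <= _)%N]r0 expn_gt0.
move=> /leq_trans/(_ le1); apply/negP; rewrite -ltnNge.
apply: (@leq_trans (M.+1 ^ r.+1)); last by rewrite leq_pexp2l.
by rewrite expnSr ltn_pmul2l // expn_gt0.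
Qed.

(** * Logarithmic forms *)

Lemma exterior_mulrn_eq0 (A : idomainType) (N k : nat) (u : exterior A N) :
  k%:R != 0 :> A -> u *+ k = 0 -> u = 0.
Proof.
move=> k_neq0 uk; apply/ffunP => S; have /ffunP/(_ S) := uk.
rewrite ffunMnE !ffunE => /eqP.
by rewrite -[X in X == _]mulr_natr mulf_eq0 (negPf k_neq0) orbF => /eqP.
Qed.

Lemma exterior_scaler_eq0 (A : idomainType) (N : nat) (c : A) (u : exterior A N) :
  c != 0 -> c *: u = 0 -> u = 0.
Proof.
move=> c_neq0 cu; apply/ffunP => S; have /ffunP/(_ S) := cu.
by rewrite !ffunE => /eqP; rewrite [_ == _]mulf_eq0 (negPf c_neq0) => /eqP.
Qed.

Definition ext_map (A B : comNzRingType) (f : A -> B) (N : nat) (u : exterior A N) :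
  exterior B N := [ffun S => f (u S)].

Lemma ext_map_wedge (A B : comNzRingType) (f : {rmorphism A -> B}) (N : nat)
    (u v : exterior A N) :
  ext_map f (wedge u v) = wedge (ext_map f u) (ext_map f v).
Proof.
apply/ffunP => S; rewrite !ffunE rmorph_sum; apply: eq_bigr => T _.
by rewrite !rmorphM rmorph_sign !ffunE.
Qed.

Lemma ext_map_biform (A B : comNzRingType) (f : {rmorphism A -> B}) (N m : nat)
    (l : 'M[A]_m) (t : 'I_m -> 'I_N -> A) :
  ext_map f (biform l t) = biform (map_mx f l) (fun i k => f (t i k)).
Proof.
have map_form1 h : ext_map f (form1 h) = form1 (fun k => f (h k)).
  apply/ffunP => S; rewrite ffunE !sum_ffunE rmorph_sum; apply: eq_bigr => i _.
  by rewrite !ffunE rmorphM rmorph_nat.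
apply/ffunP => S; rewrite ffunE !sum_ffunE rmorph_sum; apply: eq_bigr => i _.
rewrite !sum_ffunE rmorph_sum; apply: eq_bigr => j _.
have scaleE (R : comNzRingType) (c : R) (u : exterior R N) : (c *: u) S = c * (u S : R).
  by rewrite ffunE.
by rewrite mxE -!map_form1 -ext_map_wedge !scaleE rmorphM [in RHS]ffunE.
Qed.

Lemma biform_scale (A : comNzRingType) (N m : nat) (l : 'M[A]_m) (c : A)
    (t : 'I_m -> 'I_N -> A) :
  biform l (fun i k => c * t i k) = (c * c) *: biform l t.
Proof.
rewrite scaler_sumr; apply: eq_bigr => i _; rewrite scaler_sumr; apply: eq_bigr => j _.
rewrite !form1Z wedgeZl wedgeZr !scalerA; congr (_ *: _); ring.
Qed.

Lemma biform_bivector (A : comNzRingType) (m : nat) (l : 'M[A]_m) :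
  antisymmetric_mx l -> biform l (fun i k => (i == k)%:R) = bivector l *+ 2.
Proof.
move=> l_anti.
have form1_delta (i : 'I_m) : form1 (fun k => (i == k)%:R) = ext_basis A i.
  rewrite /form1 (bigD1 i) //= eqxx scale1r big1 ?addr0 // => k nki.
  by rewrite eq_sym (negPf nki) scale0r.
have -> : biform l (fun i k => (i == k)%:R)
    = \sum_i \sum_j l i j *: wedge (ext_basis A i) (ext_basis A j).
  by apply: eq_bigr => i _; apply: eq_bigr => j _; rewrite !form1_delta.
pose X (i j : 'I_m) : exterior A m :=
  if (i < j)%N then l i j *: wedge (ext_basis A i) (ext_basis A j) else 0.
have -> : bivector l = \sum_i \sum_j X i j.
  by apply: eq_bigr => i _; rewrite big_mkcond.
rewrite mulr2n [X in _ = _ + X]exchange_big -big_split; apply: eq_bigr => i _ /=.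
rewrite -big_split; apply: eq_bigr => j _ /=; rewrite /X.
case: (ltngtP i j) => [_|_|/val_inj ->]; rewrite ?addr0 ?add0r //.
  by rewrite wedge_basisC (anti_coord l_anti i j) scaleNr scalerN opprK.
have -> : wedge (ext_basis A j) (ext_basis A j) = 0.
  by apply/ffunP => S; rewrite wedge_basisE eqxx /= mulr0 ffunE.
by rewrite scaler0.
Qed.

(** Apply the two criteria for [biform] to the standard covectors, which are their own duals with
    weights 1. *)
Lemma bivector_sq_eq0P (K : numFieldType) (m : nat) (l : 'M[K]_m) :
  antisymmetric_mx l ->
  wedge (bivector l) (bivector l) = 0 <-> forall a b c q, pfaffian l a b c q = 0.
Proof.
move=> l_anti; pose t (i k : 'I_m) : K := (i == k)%:R.
have sqE : wedge (biform l t) (biform l t) = wedge (bivector l) (bivector l) *+ 4.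
  by rewrite biform_bivector // linearMn /= [X in wedge X _]mulr2n wedgeDl -mulr2n -mulrnA.
split=> [sq0 a b c q|pf0]; last first.
  (* The 4 comes from [sqE] and the 3 from [biform_sq_of_pfaffian]. *)
  apply: (@exterior_mulrn_eq0 K _ (4 * 3)); first by rewrite pnatr_eq0.
  by rewrite mulrnA -sqE; apply: biform_sq_of_pfaffian.
have dual a' j : pairing (fun k => (a' == k)%:R) (t j) = (a' == j)%:R * 1 :> K.
  rewrite /pairing (bigD1 a') //= eqxx mul1r big1 ?addr0 => [|k nk].
    by rewrite mulr1 eq_sym.
  by rewrite eq_sym (negPf nk) mul0r.
have := pfaffian_of_biform_sq l_anti dual a b c q.
rewrite sqE sq0 mul0rn => /(_ erefl) /eqP.
by rewrite -mulr_natr !mul1r mulf_eq0 pnatr_eq0 orbF => /eqP.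
Qed.

Section LogForm.
Variables (K : numFieldType) (N m : nat) (l : 'M[K]_m) (F : 'I_m -> {mpoly K[N]}).
Hypothesis l_anti : antisymmetric_mx l.

(** F times the logarithmic differential of F_i, which clears the denominator. *)
Definition cofactor_gradient (i : 'I_m) (k : 'I_N) : {mpoly K[N]} :=
  (\prod_(j | j != i) F j) * (F i)^`M(k).

(** Off the diagonal, F times the product omitting F_i and F_j is (F / F_i) (F / F_j); on the
    diagonal [l i i] vanishes by antisymmetry. *)
Lemma prod_log_form :
  (\prod_i F i) *: log_form l F = biform (map_mx (@mpolyC N K) l) cofactor_gradient.
Proof.
have l_diag i : l i i = 0.
  by apply/eqP; rewrite -[_ == 0](@mulrn_eq0 _ _ 2) mulr2n {2}(anti_coord l_anti) subrr.
rewrite scaler_sumr; apply: eq_bigr => i _.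
rewrite [RHS](bigD1 i) //= mxE l_diag mpolyC0 scale0r add0r scaler_sumr.
apply: eq_bigr => j nji; rewrite mxE !form1Z wedgeZl wedgeZr !scalerA.
congr (_ *: _).
rewrite (bigD1 i) //= (bigD1 (P := fun k => k != i) j) //=.
rewrite [X in _ = _ * _ * X](bigD1 i) 1?eq_sym //=.
rewrite [X in _ * _ * (F i * X)](eq_bigl (fun k => (k != i) && (k != j))); last first.
  by move=> k; rewrite andbC.
ring.
Qed.

End LogForm.

(** * Restriction to a parametrised curve *)

Section Substitution.
Variables (K : fieldType) (N : nat) (h : 'I_N -> {poly K}).
Local Notation sub := (mmap (@polyC K) h).

Lemma horner_mmap (F : {mpoly K[N]}) (c : K) : (sub F).[c] = F.@[fun k => (h k).[c]].
Proof.
rewrite /mmap mevalE horner_sum; apply: eq_bigr => mu _.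
rewrite hornerM hornerC horner_prod; congr (_ * _).
by apply: eq_bigr => k _; rewrite horner_exp.
Qed.

(** The chain rule. Both sides are additive and obey the Leibniz rule, so constants and variables
    suffice. *)
Lemma deriv_mmap (F : {mpoly K[N]}) :
  (sub F)^`() = \sum_k (h k)^`() * sub (F^`M(k)).
Proof.
pose P (G : {mpoly K[N]}) := (sub G)^`() = \sum_k (h k)^`() * sub (G^`M(k)).
have PC c : P c%:MP.
  rewrite /P mmapC derivC big1 // => k _; by rewrite mderivC mmap0 mulr0.
have PM G G' : P G -> P G' -> P (G * G').
  rewrite /P rmorphM derivM => -> ->; rewrite mulr_suml mulr_sumr -big_split.
  by apply: eq_bigr => k _; rewrite mderivM rmorphD !rmorphM /=; ring.
have PX i : P 'X_i.
  rewrite /P mmapX mmap1U (bigD1 i) //= big1 ?addr0 => [|k nki].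
    by rewrite mderivX mnm1E eqxx scale1r -{1}[U_(i)%MM]add0m addmK mpolyX0 rmorph1 mulr1.
  by rewrite mderivX mnm1E eq_sym (negPf nki) scale0r mmap0 mulr0.
suff : P F by []; elim/mpolyind: F => [|c mu G _ _ PG].
  by rewrite -mpolyC0.
have PcX : P (c *: 'X_[mu]).
  rewrite -mul_mpolyC; apply: (PM) => //; rewrite mpolyXE_id.
  apply: (big_rec P) => [|k G' _ PG']; first by rewrite -mpolyC1.
  apply: (PM) => //; elim: (mu k) => [|e PE]; first by rewrite expr0 -mpolyC1.
  by rewrite exprS; apply: (PM).
rewrite /P rmorphD derivD PcX PG -big_split; apply: eq_bigr => k _.
by rewrite mderivD rmorphD mulrDr.
Qed.

End Substitution.

(** * Normal crossings and the Pfaffian relations *)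

Section NormalCrossings.
Variables (K : numClosedFieldType) (N m : nat) (F : 'I_m -> {mpoly K[N]}).
Hypothesis F_snc : simple_normal_crossings F.

(** The coordinate functionals of the free family of gradients, evaluated on the standard basis,
    give the dual vectors; an index with F_i(p) nonzero gets the default 0. *)
Lemma snc_dual (p : 'rV[K]_N) : p != 0 ->
  exists w : 'I_m -> 'I_N -> K, forall i j, (F i).@[p 0] = 0 -> (F j).@[p 0] = 0 ->
    pairing (w i) (fun k => (F j)^`M(k).@[p 0]) = (i == j)%:R.
Proof.
move=> p_neq0; have := F_snc p_neq0.
set s := filter _ _; set X := map _ _ => X_free.
have mem_s i : (F i).@[p 0] = 0 -> i \in s by move=> Fi0; rewrite mem_filter mem_enum Fi0 eqxx.
suff /choice[w wP] : forall i, exists w : 'I_N -> K, (F i).@[p 0] = 0 ->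
    forall j, (F j).@[p 0] = 0 -> pairing w (fun k => (F j)^`M(k).@[p 0]) = (i == j)%:R.
  by exists w => i j Fi Fj; apply: wP.
move=> i; have [si|nsi] := boolP (i \in s); last first.
  by exists (fun=> 0) => /mem_s; rewrite (negPf nsi).
have size_X : size X = size s by rewrite size_map.
have idx j : j \in s -> (index j s < size X)%N by rewrite size_X index_mem.
pose c : {scalar 'rV[K]_N} := coord (in_tuple X) (Ordinal (idx i si)).
exists (fun k => c (delta_mx 0 k)) => _ j /mem_s sj.
have -> : pairing (fun k => c (delta_mx 0 k)) (fun k => (F j)^`M(k).@[p 0])
    = c (grad_at (F j) (p)).
  rewrite [in RHS](row_sum_delta (grad_at (F j) p)) (linear_sum c); apply: eq_bigr => k _.
  by rewrite linearZ /= mxE mulrC.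
have -> : grad_at (F j) p = (in_tuple X)`_(Ordinal (idx j sj)).
  by rewrite /= (nth_map i) ?index_mem // nth_index.
rewrite [LHS](@coord_free _ _ _ (in_tuple X) (Ordinal (idx j sj)) (Ordinal (idx i si))) //.
congr ((nat_of_bool _)%:R); rewrite -val_eqE /= eq_sym.
by apply/eqP/eqP => [e|->]; first rewrite -(nth_index i si) e nth_index.
Qed.

(** A zero polynomial would vanish with its gradient at (1, ..., 1), although its dual vector pairs
    to 1 with that gradient. *)
Lemma snc_neq0 i : (0 < N)%N -> F i != 0.
Proof.
move=> N_gt0; apply/eqP => Fi0; pose p : 'rV[K]_N := const_mx 1.
have p_neq0 : p != 0.
  apply/eqP => /rowP/(_ (Ordinal N_gt0)); rewrite !mxE => /eqP.
  by rewrite oner_eq0.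
have [w wP] := snc_dual p_neq0.
have := wP i i; rewrite Fi0 meval0 eqxx => /(_ erefl erefl).
rewrite /pairing big1 => [/esym/eqP|k _]; first by rewrite oner_eq0.
by rewrite mderiv0 meval0 mulr0.
Qed.

Variable (l : 'M[K]_m).
Hypothesis l_anti : antisymmetric_mx l.

Lemma pfaffian_at_common_zero (p : 'rV[K]_N) (a b c q : 'I_m) :
  p != 0 -> (F a).@[p 0] = 0 -> (F b).@[p 0] = 0 -> (F c).@[p 0] = 0 -> (F q).@[p 0] = 0 ->
  wedge (log_form l F) (log_form l F) = 0 -> pfaffian l a b c q = 0.
Proof.
move=> p_neq0 Fa Fb Fc Fq omega_sq; have [w wP] := snc_dual p_neq0.
pose I := [pred i | (F i).@[p 0] == 0].
(* The sum of the dual vectors crosses all hypersurfaces through p with slope 1. *)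
pose v k := \sum_(i in I) w i k.
have v_grad j : j \in I -> pairing v (fun k => (F j)^`M(k).@[p 0]) = 1.
  rewrite inE => /eqP Fj.
  transitivity (\sum_(i in I) pairing (w i) (fun k => (F j)^`M(k).@[p 0])).
    by rewrite exchange_big; apply: eq_bigr => k _; rewrite mulr_suml.
  rewrite (bigD1 j) ?inE ?Fj //= wP // eqxx big1 ?addr0 // => i /andP[].
  by rewrite inE => /eqP Fi /negPf nij; rewrite wP // nij.
pose h k : {poly K} := (p 0 k)%:P + (v k)%:P * 'X.
pose sub : {rmorphism {mpoly K[N]} -> {poly K}} := mmap (@polyC K) h.
have sub0 G : (sub G).[0] = G.@[p 0].
  rewrite horner_mmap; apply: meval_eq => k.
  by rewrite /h hornerD hornerM !hornerC hornerX mulr0 addr0.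
(* For i in I, F_i has a simple zero at T = 0 on the line, its derivative there being 1; the other
   F_i are nonzero there. *)
have /choice[f fP] : forall i, exists fi : {poly K}, sub (F i) = fi * 'X^(i \in I) /\ fi.[0] != 0.
  move=> i; have [iI|niI] := boolP (i \in I); last first.
    by exists (sub (F i)); rewrite expr0 mulr1 sub0.
  have /factor_theorem[fi subF] : root (sub (F i)) 0.
    by rewrite rootE sub0; move: iI; rewrite inE.
  rewrite subr0 in subF; exists fi; rewrite expr1; split=> //.
  have := congr1 (fun g => g^`().[0]) subF.
  rewrite derivM derivX mulr1 hornerD hornerM hornerX mulr0 add0r => <-.
  rewrite deriv_mmap horner_sum.
  suff -> : \sum_k ((h k)^`() * mmap (@polyC K) h (F i)^`M(k)).[0] = 1 by rewrite oner_neq0.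
  rewrite -[RHS](v_grad i iI); apply: eq_bigr => k _.
  rewrite hornerM -[mmap _ _]/(sub : _ -> _) sub0; congr (_ * _).
  by rewrite /h derivD derivC derivM derivC derivX mul0r !add0r mulr1 hornerC.
(* As [a] lies in I, the predecessor is genuine. *)
pose s := (#|I|).-1.
have I_gt0 : (0 < #|I|)%N by apply/card_gt0P; exists a; rewrite inE Fa.
(* F / F_i restricts to 'X^s * G i on the line. *)
pose G i : {poly K} := \prod_(k | k != i) f k * 'X^(i \notin I).
have subG i : sub (\prod_(k | k != i) F k) = 'X^s * G i.
  rewrite rmorph_prod (eq_bigr _ (fun k _ => (fP k).1)) big_split /= /G mulrCA; congr (_ * _).
  rewrite prodrXr -exprD; congr ('X^_).
  (* The product over k != i carries one factor T per element of I other than i: [s] of them if i is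
     in I, [s + 1] otherwise. *)
  have : #|I| = (\sum_k (k \in I))%N.
    by rewrite -sum1_card big_mkcond; apply: eq_bigr => k _; case: (k \in I).
  rewrite (bigD1 i) //= /s; case: (i \in I) => /=; lia.
have G0 i : (F i).@[p 0] = 0 -> (G i).[0] != 0.
  move=> Fi; rewrite /G inE Fi eqxx expr0 mulr1 horner_prod.
  by apply/prodf_neq0 => k _; case: (fP k).
have G0' i : (F i).@[p 0] != 0 -> (G i).[0] = 0.
  by move=> Fi; rewrite /G inE Fi expr1 hornerM hornerX mulr0.
pose t1 i k := G i * sub (F i)^`M(k).
pose l1 := map_mx (@polyC K) l.
have sq1 : wedge (biform l1 t1) (biform l1 t1) = 0.
  (* [biform] is quadratic in the covectors, so each copy in the square yields T^(2 s), which
     cancels in a domain. *)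
  have c_neq0 : 'X^s * 'X^s != 0 :> {poly K} by rewrite mulf_neq0 ?expf_neq0 ?polyX_eq0.
  apply: (exterior_scaler_eq0 c_neq0); apply: (exterior_scaler_eq0 c_neq0).
  rewrite -wedgeZr -wedgeZl -biform_scale.
  have -> : biform l1 (fun i k => 'X^s * t1 i k)
      = ext_map sub ((\prod_i F i) *: log_form l F).
    rewrite prod_log_form // ext_map_biform; congr biform.
      by apply/matrixP => i j; rewrite !mxE; exact/esym/mmapC.
    by apply/funext => i; apply/funext => k; rewrite rmorphM /= subG mulrA.
  rewrite -ext_map_wedge wedgeZl wedgeZr omega_sq !scaler0.
  by apply/ffunP => S; rewrite !ffunE rmorph0.
pose t0 i k := (G i).[0] * (F i)^`M(k).@[p 0].
have sq0 : wedge (biform l t0) (biform l t0) = 0.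
  have -> : biform l t0 = ext_map (horner_eval 0) (biform l1 t1).
    rewrite ext_map_biform; congr biform.
      by apply/matrixP => i j; rewrite !mxE; exact/esym/hornerC.
    by apply/funext => i; apply/funext => k; rewrite [RHS]hornerM sub0.
  by rewrite -ext_map_wedge sq1; apply/ffunP => S; rewrite !ffunE rmorph0.
(* Extension by 0 off I gives duality for all indices, since the weight [(G j).[0]] vanishes there
   too. *)
pose w' i k := if i \in I then w i k else 0.
have dual i j : pairing (w' i) (t0 j) = (i == j)%:R * (G j).[0].
  have [Fj|/eqP nFj] := eqVneq (F j).@[p 0] 0; last first.
    by rewrite /pairing big1 => [|k _]; rewrite /t0 (G0' j) ?mul0r ?mulr0 //; apply/eqP.
  have -> : pairing (w' i) (t0 j) = (G j).[0] * pairing (w' i) (fun k => (F j)^`M(k).@[p 0]).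
    by rewrite mulr_sumr; apply: eq_bigr => k _; rewrite /t0; ring.
  rewrite mulrC; congr (_ * _); rewrite /w' inE.
  case: eqP => Fi; first exact: wP.
  rewrite /pairing big1 => [|k _]; last by rewrite mul0r.
  by case: eqP => // ij; rewrite ij in Fi.
have := pfaffian_of_biform_sq l_anti dual a b c q sq0 => /eqP.
by rewrite mulrn_eq0 !mulf_eq0 !(negPf (G0 _ _)) //= => /eqP.
Qed.

End NormalCrossings.

Theorem proposition2p14 (R : realType) (n m : nat) (d : 'I_m -> nat)
    (l : 'M[R[i]]_m) (F : 'I_m -> {mpoly R[i][n.+1]})
    (n_gt3 : (3 < n)%N) (m_ge3 : (3 <= m)%N)
    (d_gt0 : forall i, (0 < d i)%N)
    (l_anti : antisymmetric_mx l)
    (l_contraction : interior (fun i => (d i)%:R) (bivector l) = 0)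
    (F_homog : forall i, F i \is (d i).-homog)
    (F_snc : simple_normal_crossings F) :
  wedge (log_form l F) (log_form l F) = 0
  <-> wedge (bivector l) (bivector l) = 0.
Proof.
rewrite (bivector_sq_eq0P l_anti); split=> [omega_sq a b c q|pf0].
  (* Repeated indices only repeat a form. Four forms in n + 1 variables have a common zero because n
     > 3. *)
  pose sel := tnth [tuple a; b; c; q].
  have [x [i xi_neq0] x_zero] := @few_forms_common_zero _ _ 4 (d \o sel) (F \o sel) n_gt3
    (fun j => d_gt0 _) (fun j => F_homog _).
  pose p : 'rV[R[i]]_n.+1 := \row_k x k.
  have p_zero j : (F (sel j)).@[p 0] = 0.
    by rewrite -[RHS](x_zero j); apply: meval_eq => k; rewrite mxE.
  apply: (pfaffian_at_common_zero F_snc l_anti (p := p)) omega_sq.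
  - by apply: contraNneq xi_neq0 => /rowP/(_ i); rewrite !mxE => ->.
  - exact: (p_zero (@Ordinal 4 0 isT)).
  - exact: (p_zero (@Ordinal 4 1 isT)).
  - exact: (p_zero (@Ordinal 4 2 isT)).
  - exact: (p_zero (@Ordinal 4 3 isT)).
(* The square of F omega is F^2 times that of omega, and F can be cancelled twice. *)
have prod_neq0 : \prod_i F i != 0 by apply/prodf_neq0 => i _; apply: snc_neq0.
apply: (exterior_scaler_eq0 prod_neq0); apply: (exterior_scaler_eq0 prod_neq0).
rewrite -wedgeZr -wedgeZl prod_log_form //.
apply: (@exterior_mulrn_eq0 _ _ 3).
  by rewrite -(rmorph_nat (@mpolyC n.+1 R[i])) mpolyC_eq0 pnatr_eq0.
apply: biform_sq_of_pfaffian => a b c q.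
by rewrite /pfaffian !mxE -!rmorphM -rmorphB -rmorphD /= -/(pfaffian l a b c q) pf0 rmorph0.
Qed.
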